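(* Consider the LCQ($d$) queueing system of size $n$ described in the context, with $d\ge 1$ fixed, $\lambda<1$ and $q\in(0,1]$. Then every subsequence of $\{n\}$ has a further subsequence along which the process $\mathbf{u}(\cdot)=(\mathbf{u}(t):t\ge 0)$ converges in distribution (in the Skorokhod space $D_U[0,\infty)$) to a differentiable process $\mathbf{v}(\cdot)$ such that $v_0(t)\equiv 1$ and \[\frac{d}{dt}v_k(t)=\lambda(v_{k-1}(t)-v_k(t))-(1-v_{k+1}(t))^d+(1-v_{k}(t))^d,\qquad k=1,2,\dots\]
   Context: System model: there are $n$ queues. Packets arrive to each queue according to independent Poisson processes of rate $\lambda<1$. Packet transmission times are i.i.d. exponential with mean $n^{-1}$. At most one queue transmits at a time. At each scheduling instant each queue is independently ''connected'' with probability $q\in(0,1]$, independently of queue lengths and of the past; channel states stay fixed during a transmission. The LCQ($d$) policy selects $d$ connected queues uniformly at random, independently, with repetitions allowed, and transmits a packet from a longest selected queue; if all selected queues are empty or no queue is connected, the scheduler idles for an exponential time of mean $n^{-1}$ and then makes a new decision (so scheduling instants form a Poisson process of rate $n$). Let $m_k(t)$ be the number of queues with at least $k$ packets at time $t$ and $u_k(t)=m_k(t)/n$, $k=0,1,2,\dots$; $\mathbf{u}(t)=\{u_k(t)\}_{k\ge 0}$. Let $U$ be the set of sequences $\mathbf{u}=\{u_k\}_{k\ge0}$ with $1=u_0\ge u_1\ge u_2\ge\cdots\ge 0$, with metric $\rho(\mathbf{u},\mathbf{u}')=\sup_{k>0}|u_k-u'_k|/k$ (convergence is coordinatewise; $U$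 is compact). Equivalently, $\mathbf{u}(\cdot)$ is the Markov process on $U$ jumping from $\mathbf{u}$ to $\mathbf{u}+n^{-1}\mathbf{e}_k$ at rate $n\lambda(u_{k-1}-u_k)$ and to $\mathbf{u}-n^{-1}\mathbf{e}_k$ at rate $n\alpha_n((1-u_{k+1})^d-(1-u_k)^d)$, $k\ge1$, where $\alpha_n=1-(1-q)^n$ and $\mathbf{e}_k$ is the sequence with $1$ in coordinate $k$ and $0$ elsewhere. *)

(* Defs.v *)
From HB Require Import structures.
From mathcomp Require Import all_boot all_order all_algebra.
From mathcomp Require Import all_classical all_reals all_analysis.
Set Implicit Arguments. Unset Strict Implicit. Unset Printing Implicit Defensive.
Import Order.TTheory GRing.Theory Num.Theory.
Import numFieldNormedType.Exports.
Local Open Scope classical_set_scope.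
Local Open Scope ring_scope.

Section LCQ.
Variable R : realType.

Definition seqR := nat -> R.
(* a path of the process: t |-> u(t) (only t >= 0 matters) *)
Definition pathR := R -> seqR.

Definition Uset : set seqR :=
  [set u | u 0%N = 1 /\ (forall k, u k.+1 <= u k) /\ (forall k, 0 <= u k)].

Definition rho (u u' : seqR) : R :=
  sup [set `|u k - u' k| / k%:R | k in [set k : nat | (0 < k)%N]].

Definition cadlag (x : pathR) : Prop :=
  (forall t, 0 <= t -> Uset (x t)) /\
  (forall t, 0 <= t -> forall e, 0 < e -> exists2 del, 0 < del &
      forall s, t <= s -> s < t + del -> rho (x s) (x t) < e) /\
  (forall t, 0 < t -> exists2 l, Uset l &
      forall e, 0 < e -> exists2 del, 0 < del &
      forall s, 0 <= s -> t - del < s -> s < t -> rho (x s) l < e).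

Definition time_change (mu : R -> R) : Prop :=
  (forall s t, 0 <= s -> s < t -> mu s < mu t) /\
  (forall t, 0 <= t -> 0 <= mu t) /\
  (forall y, 0 <= y -> exists2 t, 0 <= t & mu t = y) /\
  (forall t, 0 <= t -> forall e, 0 < e -> exists2 del, 0 < del &
      forall s, 0 <= s -> `|s - t| < del -> `|mu s - mu t| < e).

(* convergence in the Skorokhod (J1) topology of D_U[0,oo)
   (Ethier--Kurtz, Prop. 3.5.3 (b)) *)
Definition sk_conv (xs : nat -> pathR) (x : pathR) : Prop :=
  exists mu : nat -> R -> R, (forall n, time_change (mu n)) /\
    forall T, 0 < T -> forall e, 0 < e -> exists N, forall n, (N <= n)%N ->
      forall t, 0 <= t -> t <= T ->
        `|mu n t - t| < e /\ rho (xs n t) (x (mu n t)) < e.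

(* continuity of a functional on D_U[0,oo) (the topology is metrizable, so
   sequential continuity is continuity) *)
Definition sk_continuous (f : pathR -> R) : Prop :=
  forall (xs : nat -> pathR) (x : pathR),
    (forall n, cadlag (xs n)) -> cadlag x -> sk_conv xs x ->
    (fun n => f (xs n)) @ \oo --> f x.

Definition bounded_fun (f : pathR -> R) : Prop :=
  exists M : R, forall x, `|f x| <= M.

(* X is a random element of D_U[0,oo) (Borel measurable: equivalently,
   f o X is measurable for every bounded continuous f) *)
Definition random_element d (Om : measurableType d) (X : Om -> pathR) : Prop :=
  (forall w, cadlag (X w)) /\
  forall f, bounded_fun f -> sk_continuous f -> measurable_fun setT (fun w => f (X w)).

Definition conv_dist (dn : nat -> measure_display)
  (Om : forall j, measurableType (dn j)) (P : forall j, probability (Om j) R)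
  (X : forall j, Om j -> pathR)
  d' (Om' : measurableType d') (P' : probability Om' R) (V : Om' -> pathR) : Prop :=
  forall f, bounded_fun f -> sk_continuous f ->
    (fun j => (\int[P j]_w (f (X j w))%:E)%E) @ \oo --> (\int[P']_w (f (V w))%:E)%E.

Definition series_sum (a : nat -> R) : R := limn (series a).

Definition alpha (n : nat) (q : R) : R := 1 - (1 - q) ^+ n.

(* states reachable by the size-n system: u in U, n u_k integer, finitely
   many nonempty queues *)
Definition Sn (n : nat) : set seqR :=
  [set u | Uset u /\ (forall k, exists m : nat, n%:R * u k = m%:R) /\
           (exists K, forall k, (K <= k)%N -> u k = 0)].

Definition shift (x : seqR) (k : nat) (s : R) : seqR :=
  fun i => if i == k.+1 then x i + s else x i.

(* uniformization at rate c = n (lam + 1): jump probabilities of the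
   embedded kernel K = I + Q / c *)
Definition upK (lam : R) (x : seqR) (k : nat) : R :=
  lam * (x k - x k.+1) / (lam + 1).          (* to x + e_{k+1}/n *)
Definition dnK (n : nat) (lam q : R) (d : nat) (x : seqR) (k : nat) : R :=
  alpha n q * ((1 - x k.+2) ^+ d - (1 - x k.+1) ^+ d) / (lam + 1).
                                              (* to x - e_{k+1}/n *)
Definition diagK n lam q d (x : seqR) : R :=
  1 - series_sum (fun k => upK lam x k + dnK n lam q d x k).

Fixpoint Kpow n lam q d (j : nat) (x y : seqR) {struct j} : R :=
  match j with
  | 0%N => if asbool (x = y) then 1 else 0
  | j'.+1 => diagK n lam q d x * Kpow n lam q d j' x y +
      series_sum (fun k =>
        upK lam x k * Kpow n lam q d j' (shift x k (n%:R^-1)) y +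
        dnK n lam q d x k * Kpow n lam q d j' (shift x k (- n%:R^-1)) y)
  end.

(* transition function p_t(x,y) = (exp(tQ))(x,y) *)
Definition ptrans n lam q d (t : R) (x y : seqR) : R :=
  let c := n%:R * (lam + 1) in
  series_sum (fun j => expR (- (c * t)) * (c * t) ^+ j / (j`!)%:R *
                       Kpow n lam q d j x y).

(* X is (a version of) the process u(.) of the LCQ(d) system of size n,
   with an arbitrary initial distribution on the reachable states:
   a cadlag Markov process with transition function ptrans. *)
Definition is_LCQ_process (n : nat) (lam q : R) (d : nat)
  dm (Om : measurableType dm) (P : probability Om R) (X : Om -> pathR) : Prop :=
  (forall w, cadlag (X w)) /\
  (forall w t, 0 <= t -> Sn n (X w t)) /\
  (forall t x, measurable [set w | X w t = x]) /\
  (forall (m : nat) (ts : nat -> R) (xs : nat -> seqR),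
     0 <= ts 0%N -> (forall i, ts i <= ts i.+1) ->
     P [set w | forall i, (i <= m)%N -> X w (ts i) = xs i] =
     (P [set w | X w (ts 0%N) = xs 0%N] *
      (\prod_(i < m) ptrans n lam q d (ts i.+1 - ts i) (xs i) (xs i.+1))%:E)%E).

Definition lcq_rhs (lam : R) (d : nat) (v : seqR) (k : nat) : R :=
  lam * (v k.-1 - v k) - (1 - v k.+1) ^+ d + (1 - v k) ^+ d.

End LCQ.

(* Main.v *)
Require Import Defs.
From HB Require Import structures.
From mathcomp Require Import all_boot all_order all_algebra.
From mathcomp Require Import all_classical all_reals all_analysis.
From mathcomp Require Import measurable_realfun ring lra.
Import Order.TTheory GRing.Theory Num.Theory.
Import numFieldNormedType.Exports.
Local Open Scope classical_set_scope.
Local Open Scope ring_scope.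

(* The right-hand side of the ODE is Lipschitz for [rho] and [u + h F(u)] stays
   in U for small [h], so the ODE has a unique flow on the compact space U, and
   this flow depends continuously on the initial state.

   Let [Phi] be the weighted sum of the squared coordinate differences between
   the state of the n-th system and the flow started at the same state.  The
   first-order expansion of the transition function shows that over a time step
   of length h the expectation of [Phi] grows at most by a factor 1 + O(h), up
   to an additive h o(1) as n tends to infinity.  The maximal inequality for
   nonnegative supermartingales on finer and finer dyadic grids then bounds the
   distance between path and flow uniformly on [0, T], in probability.

   Hence only the initial laws matter.  Coding a state of U by countably many
   bits, a diagonal subsequence makes the probabilities of all finite words
   converge; nested subintervals of [0, 1) of the limiting lengths realise the
   limit as a random initial state V0 on [0, 1) with Lebesgue measure.  The limit
   process is the flow started at V0, and convergence in distribution follows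
   because a continuous functional is uniformly continuous around the compact
   set of flow lines. *)

(** * The state space *)

(** The transition function is a Poisson series with nonnegative terms, so its first two terms bound
    it from below; an upper bound on the expectation of a cost [g <= M] then comes from a lower
    bound on that of [M - g]. The second-order error of one step of length h is of size (n h)^2.
    Over T / h steps this adds up to about T n^2 h, which vanishes when the grid is refined for
    fixed n, before n grows. What remains per unit of time is of order 1/n (squares of the jumps),
    (1 - q)^n (the gap between alpha_n and 1) and 2^-m, where m is the number of coordinates kept in
    [Phi]; the choice m = n makes all three vanish. The drift of coordinate k involves the
    coordinates k - 1 and k + 1. The weights of [Phi] therefore halve from one coordinate to the
    next: a shift of the index costs at most a factor 2 and a boundary term of order 2^-m. Since
    paths stay close to flow lines with the same initial state, compactness enters only through U,
    by way of diagonal subsequences of initial states. *)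

Lemma exprn_sub_le {R : realType} (a b : R) d :
  0 <= a -> a <= b -> b <= 1 -> b ^+ d - a ^+ d <= d%:R * (b - a).
Proof.
move=> a0 ab b1; elim: d => [|d IH]; first by rewrite !expr0 mul0r subrr.
have ad0 : 0 <= a ^+ d by apply: exprn_ge0.
have ad1 : a ^+ d <= 1 by apply: exprn_ile1 => //; lra.
have bd : a ^+ d <= b ^+ d by apply: lerXn2r => //; rewrite nnegrE; lra.
rewrite !exprS -natr1; nra.
Qed.

Section StateSpace.
Variable R : realType.
Implicit Types (u : seqR R) (k : nat).

Lemma Uset_ge0 u k : Uset u -> 0 <= u k.
Proof. by case=> _ [_]. Qed.

Lemma Uset_le1 u k : Uset u -> u k <= 1.
Proof.
case=> u0 [ud _]; elim: k => [|k IH]; first by rewrite u0.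
exact: le_trans (ud k) IH.
Qed.

Lemma Uset_S u k : Uset u -> u k.+1 <= u k.
Proof. by case=> _ []. Qed.

Lemma Uset_dist u u' k : Uset u -> Uset u' -> `|u k - u' k| <= 1.
Proof.
move=> Uu Uu'; have := Uset_ge0 u k Uu; have := Uset_le1 u k Uu.
have := Uset_ge0 u' k Uu'; have := Uset_le1 u' k Uu'.
by rewrite ler_norml; lra.
Qed.

Lemma Uset_pow u k d : Uset u -> 0 <= (1 - u k) ^+ d <= 1.
Proof.
move=> Uu; have := Uset_ge0 u k Uu; have := Uset_le1 u k Uu => h1 h0.
by rewrite exprn_ge0 ?exprn_ile1//; lra.
Qed.

Lemma Uset_powD u k d : Uset u ->
  0 <= (1 - u k.+1) ^+ d - (1 - u k) ^+ d <= d%:R * (u k - u k.+1).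
Proof.
move=> Uu; have h1 := Uset_ge0 u k.+1 Uu; have h2 := Uset_le1 u k Uu.
have h3 := Uset_S u k Uu.
apply/andP; split; first by rewrite subr_ge0 lerXn2r// ?nnegrE; lra.
rewrite [X in _ * X](_ : _ = (1 - u k.+1) - (1 - u k)); last lra.
by apply: exprn_sub_le; lra.
Qed.

Lemma Uset_powD_le1 u k d : Uset u -> (1 - u k.+1) ^+ d - (1 - u k) ^+ d <= 1.
Proof.
move=> Uu; have /andP[_ h1] := Uset_pow u k.+1 d Uu.
by have /andP[h2 _] := Uset_pow u k d Uu; lra.
Qed.

Lemma rho_le u u' e : (forall k, (0 < k)%N -> `|u k - u' k| / k%:R <= e) ->
  rho u u' <= e.
Proof.
move=> h; apply: ge_sup; first by exists (`|u 1%N - u' 1%N| / 1%:R); exists 1%N.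
by move=> _ [k k0 <-]; apply: h.
Qed.

Lemma rho_ge u u' k : Uset u -> Uset u' -> (0 < k)%N ->
  `|u k - u' k| <= k%:R * rho u u'.
Proof.
move=> Uu Uu' k0; have kR : 0 < k%:R :> R by rewrite ltr0n.
rewrite mulrC -ler_pdivrMr//; apply: ub_le_sup; last by exists k.
exists 1 => _ [i i0 <-]; rewrite ler_pdivrMr ?ltr0n// mul1r.
by apply: (le_trans (Uset_dist _ _ _ Uu Uu')); rewrite ler1n.
Qed.

Lemma rho_xx u : rho u u = 0.
Proof.
rewrite /rho [X in sup X](_ : _ = [set 0]) ?sup1//; apply/seteqP; split.
  by move=> _ [k _ <-]; rewrite subrr normr0 mul0r.
by move=> _ ->; exists 1%N => //; rewrite subrr normr0 mul0r.
Qed.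

(** Coordinates past [N] differ by at most 1 and are divided by more than [N], so they contribute at
    most [N%:R^-1]. This turns estimates on finitely many coordinates into estimates for [rho]. *)
Lemma rho_le_coord u u' e N : Uset u -> Uset u' -> 0 <= e -> (0 < N)%N ->
  N%:R^-1 <= e -> (forall k, (k <= N)%N -> `|u k - u' k| <= e) ->
  rho u u' <= e.
Proof.
move=> Uu Uu' e0 N0 Ne h; apply: rho_le => k k0.
have kR : 0 < k%:R :> R by rewrite ltr0n.
have k1 : 1 <= k%:R :> R by rewrite ler1n.
rewrite ler_pdivrMr//; have [kN|kN] := leqP k N.
  by apply: (le_trans (h _ kN)); nra.
apply: (le_trans (Uset_dist _ _ _ Uu Uu')).
have NR : 0 < N%:R :> R by rewrite ltr0n.
have : 1 <= e * N%:R by rewrite -ler_pdivrMr// mul1r.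
have : N%:R <= k%:R :> R by rewrite ler_nat ltnW.
nra.
Qed.

End StateSpace.

(** * Euler steps for the differential equation *)

Section Euler.
Variables (R : realType) (lam : R) (d : nat).
Hypotheses (lam0 : 0 <= lam) (lam1 : lam <= 1).
Implicit Types (u : seqR R) (k : nat).

Lemma lcq_rhs_le1 u k : Uset u -> `|lcq_rhs lam d u k.+1| <= 1.
Proof.
move=> Uu; rewrite /lcq_rhs /=.
have /andP[h1 _] := Uset_powD _ u k.+1 d Uu.
have h2 := Uset_powD_le1 _ u k.+1 d Uu.
have h3 := Uset_ge0 _ u k.+1 Uu; have h4 := Uset_le1 _ u k Uu.
have h5 := Uset_S _ u k Uu.
have h6 : 0 <= lam * (u k - u k.+1) <= 1.
  by rewrite mulr_ge0 ?mulr_ile1//; lra.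
by rewrite ler_norml; lra.
Qed.

Lemma pow_lip u u' k (e : R) : Uset u -> Uset u' -> `|u k - u' k| <= e ->
  `|(1 - u k) ^+ d - (1 - u' k) ^+ d| <= d%:R * e.
Proof.
wlog uu' : u u' / u k <= u' k => [hw Uu Uu'|].
  have [?|/ltW ?] := leP (u k) (u' k); first exact: hw.
  by move=> ee; rewrite distrC; apply: hw => //; rewrite distrC.
move=> Uu Uu' ee; have h1 := Uset_ge0 _ u k Uu; have h2 := Uset_le1 _ u' k Uu'.
have h3 : (1 - u' k) ^+ d <= (1 - u k) ^+ d by rewrite lerXn2r// ?nnegrE; lra.
rewrite ger0_norm; last lra.
apply: (@le_trans _ _ (d%:R * ((1 - u k) - (1 - u' k)))).
  by apply: exprn_sub_le; lra.
rewrite ler_wpM2l// (le_trans _ ee)// distrC.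
rewrite (_ : 1 - u k - (1 - u' k) = u' k - u k) ?ler_norm//; lra.
Qed.

Lemma lcq_rhs_lip u u' k (a b c : R) : Uset u -> Uset u' ->
  `|u k - u' k| <= a -> `|u k.+1 - u' k.+1| <= b -> `|u k.+2 - u' k.+2| <= c ->
  `|lcq_rhs lam d u k.+1 - lcq_rhs lam d u' k.+1| <=
    lam * (a + b) + d%:R * (b + c).
Proof.
move=> Uu Uu' ha hb hc; rewrite /lcq_rhs /=.
have pb := pow_lip _ _ _ _ Uu Uu' hb.
have pc := pow_lip _ _ _ _ Uu Uu' hc.
have ab : `|lam * ((u k - u' k) - (u k.+1 - u' k.+1))| <= lam * (a + b).
  rewrite normrM ger0_norm// ler_wpM2l//.
  by apply: (le_trans (ler_normB _ _)); lra.
move: pb pc ab; rewrite !ler_norml; lra.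
Qed.

Definition euler (h : R) u : seqR R :=
  fun k => if k is k'.+1 then u k + h * lcq_rhs lam d u k else u k.

(** The departure term is at most [d%:R] times the gap [u k - u k.+1], so a step takes from each gap
    at most [h * (lam + d%:R)] times that gap, and the bound on [h] keeps this below the gap. The
    other terms only widen it. *)
Lemma euler_Uset h u : 0 <= h -> h * (1 + d%:R) <= 1 -> Uset u ->
  Uset (euler h u).
Proof.
move=> h0 h1 Uu; have d0 : 0 <= d%:R :> R by [].
have l1 := lam1.
have hl : h * lam <= h by nra.
have hdd : 0 <= h * d%:R by nra.
split; first by case: Uu.
split; case=> [|k]; rewrite /euler /lcq_rhs /=.
- have /andP[p1 _] := Uset_powD _ u 1 d Uu.
  have a1 := Uset_le1 _ u 1 Uu; have -> : u 0%N = 1 by case: Uu.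
  have hp : 0 <= h * ((1 - u 2%N) ^+ d - (1 - u 1%N) ^+ d) by exact: mulr_ge0.
  nra.
- have /andP[p1 q1] := Uset_powD _ u k.+1 d Uu.
  have /andP[p2 q2] := Uset_powD _ u k.+2 d Uu.
  have s0 := Uset_S _ u k Uu; have s1 := Uset_S _ u k.+1 Uu.
  have hp : 0 <= h * ((1 - u k.+3) ^+ d - (1 - u k.+2) ^+ d) by exact: mulr_ge0.
  have hq : h * ((1 - u k.+2) ^+ d - (1 - u k.+1) ^+ d) <=
      h * (d%:R * (u k.+1 - u k.+2)) by rewrite ler_wpM2l.
  have hs : 0 <= h * lam * (u k - u k.+1).
    by apply: mulr_ge0; [exact: mulr_ge0|lra].
  have ht : (h * lam + h * d%:R) * (u k.+1 - u k.+2) <= u k.+1 - u k.+2.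
    by rewrite -[leRHS]mul1r ler_wpM2r//; lra.
  nra.
- by have := Uset_ge0 _ u 0 Uu.
- have /andP[p1 q1] := Uset_powD _ u k.+1 d Uu.
  have s0 := Uset_S _ u k Uu; have s1 := Uset_S _ u k.+1 Uu.
  have s2 := Uset_ge0 _ u k.+2 Uu.
  have hq : h * ((1 - u k.+2) ^+ d - (1 - u k.+1) ^+ d) <=
      h * (d%:R * (u k.+1 - u k.+2)) by rewrite ler_wpM2l.
  have hs : 0 <= h * lam * (u k - u k.+1).
    by apply: mulr_ge0; [exact: mulr_ge0|lra].
  have ht : h * d%:R * (u k.+1 - u k.+2) <= u k.+1 - u k.+2.
    by rewrite -[leRHS]mul1r ler_wpM2r//; lra.
  nra.
Qed.

(** A Lipschitz constant of the right-hand side for the supremum distance when [lam <= 1]. As the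
    speed is at most 1, it also serves as the second-order constant below. *)
Definition lipF : R := 2 * (1 + d%:R).

(* Solutions of the ODE, expressed by a uniform second-order Taylor estimate:
   this form passes to limits without integrals or derivatives. *)
Definition is_flow (v : pathR R) : Prop :=
  (forall t, 0 <= t -> Uset (v t)) /\
  (forall t h k, 0 <= t -> 0 <= h ->
    `|v (t + h) k.+1 - v t k.+1 - h * lcq_rhs lam d (v t) k.+1|
      <= lipF * h ^+ 2).

Section EulerIteration.
Variables (h : R) (u : seqR R).
Hypotheses (h0 : 0 <= h) (h1 : h * (1 + d%:R) <= 1) (Uu : Uset u).
Let E j := iter j (euler h) u.

Lemma euler_iter_Uset j : Uset (E j).
Proof. by elim: j => [//|j IH]; rewrite /E iterS; exact: euler_Uset. Qed.

Lemma euler_iter_dist j i k : `|E (i + j) k - E j k| <= i%:R * h.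
Proof.
elim: i => [|i IH]; first by rewrite add0n subrr normr0 mul0r.
case: k IH => [_|k IH].
  have e0 l : E l 0%N = 1 by case: (euler_iter_Uset l).
  by rewrite !e0 subrr normr0 mulr_ge0.
rewrite addSn /E iterS -/(E _) /= -natr1.
have hF := lcq_rhs_le1 (E (i + j)) k (euler_iter_Uset _).
have hh : `|h * lcq_rhs lam d (E (i + j)) k.+1| <= h.
  by rewrite normrM ger0_norm// ler_piMr.
by move: IH hh; rewrite !ler_norml /E; lra.
Qed.

(** Put [x = i%:R * h]. After [i] steps the state has moved by at most [x], so the right-hand side
    has changed by at most [lipF * x]; the next step adds [lipF * x * h], and
    [x ^+ 2 + x * h <= (x + h) ^+ 2]. *)
Lemma euler_iter_lin j i k :
  `|E (i + j) k.+1 - E j k.+1 - i%:R * h * lcq_rhs lam d (E j) k.+1| <=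
    lipF * (i%:R * h) ^+ 2.
Proof.
elim: i => [|i IH].
  by rewrite add0n subrr !mul0r subr0 normr0 mulr_ge0 ?exprn_ge0 ?mulr_ge0 ?addr_ge0.
rewrite addSn /E iterS -/(E _) -/(E _) [euler _ _ _]/= -natr1.
have D := euler_iter_dist j i.
have hL := lcq_rhs_lip (E (i + j)) (E j) k _ _ _ (euler_iter_Uset _)
   (euler_iter_Uset _) (D k) (D k.+1) (D k.+2).
have l0 := lam0; have l1 := lam1; have h0' := h0.
set x := i%:R * h in IH hL *.
have x0 : 0 <= x by exact: mulr_ge0.
have d0 : 0 <= d%:R :> R by [].
have hL' : `|lcq_rhs lam d (E (i + j)) k.+1 - lcq_rhs lam d (E j) k.+1| <=
    lipF * x by apply: (le_trans hL); rewrite /lipF; nra.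
have hh : `|h * (lcq_rhs lam d (E (i + j)) k.+1 - lcq_rhs lam d (E j) k.+1)| <=
    h * (lipF * x) by rewrite normrM ger0_norm// ler_wpM2l.
have -> : (i%:R + 1) * h = x + h by rewrite mulrDl mul1r.
have L0 : 0 <= lipF by rewrite /lipF; lra.
have : 0 <= lipF * (x * h) by rewrite !mulr_ge0.
have : 0 <= lipF * (h * h) by rewrite !mulr_ge0.
by move: IH hh; rewrite !ler_norml !expr2; nra.
Qed.

End EulerIteration.
End Euler.

(** * Existence of the flow *)

(** The restriction [e <= 1] allows higher powers of [e] to be absorbed into the linear term
    [e * C]. *)
Lemma ler_addM_eps {R : realType} (x y C : R) : 0 <= C ->
  (forall e, 0 < e -> e <= 1 -> x <= y + e * C) -> x <= y.
Proof.
move=> C0 h; apply/ler_addgt0Pr => e e0.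
pose e' := Num.min 1 (e / (C + 1)).
have C1 : 0 < C + 1 by lra.
have ec : 0 < e / (C + 1) by rewrite divr_gt0.
have e'0 : 0 < e' by rewrite lt_min ltr01.
apply: (le_trans (h e' e'0 _)); first by rewrite ge_min lexx.
rewrite lerD2l (@le_trans _ _ (e / (C + 1) * (C + 1)))//.
  by apply: ler_pM => //; [exact: ltW|rewrite ge_min lexx orbT|lra].
by rewrite divfK// gt_eqF.
Qed.

Lemma ultra_unit_cvg {R : realType} {T : Type} (G : set_system T)
    (a : T -> R) : UltraFilter G -> (forall n, 0 <= a n <= 1) ->
  exists l : R, a @ G --> l.
Proof.
move=> UG a01.
have aG : (a @ G) `[0, 1]%classic.
  apply: (@filterS _ G _ setT); last exact: filterT.
  by move=> n _; rewrite /= in_itv/=; exact: a01.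
have [l [_ cl]] := @segment_compact R 0 1 _ _ aG.
exists l => A /= Al; have [//|GA] := in_ultra_setVsetC (a @^-1` A) UG.
have [x [nAx Ax]] := cl (~` A) A GA Al.
by case: nAx.
Qed.

Lemma ultra_oo : exists2 G : set_system nat, UltraFilter G & \oo `<=` G.
Proof.
have [G [UG sG]] := @ultraFilterLemma nat \oo _.
by exists G.
Qed.

(* One ultrafilter finer than the cofinite filter makes all rows converge at
   once, and the subsequence is then read off greedily. *)
Lemma diagonal_subsequence {R : realType} (a : nat -> nat -> R) :
  (forall j n, 0 <= a j n <= 1) ->
  exists psi : nat -> nat, (forall j, (psi j < psi j.+1)%N) /\
    exists l : nat -> R, forall j, (fun n => a j (psi n)) @ \oo --> l j.
Proof.
move=> a01; have [G UG sG] := ultra_oo.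
have [l al] := choice (fun j => ultra_unit_cvg G (a j) UG (a01 j)).
pose good i n := forall j, (j <= i)%N -> `|l j - a j n| <= i.+1%:R^-1.
have goodG i : G (good i).
  have : \forall n \near G, forall j : 'I_i.+1, `|l j - a j n| <= i.+1%:R^-1.
    apply: filter_forall => j.
    by have /cvgrPdist_le := al j; apply; rewrite invr_gt0.
  apply: filterS => n h j ji.
  by have := h (Ordinal (ji : (j < i.+1)%N)).
have ex i m : exists n, (m < n)%N /\ good i n.
  have : G [set n | (m < n)%N /\ good i n].
    apply: filterI; [apply: sG; exact: nbhs_infty_gt|exact: goodG].
  by move/filter_ex => [n ?]; exists n.
pose nx i m := projT1 (cid (ex i m)).
have nxP i m : (m < nx i m)%N /\ good i (nx i m) by exact: projT2 (cid (ex i m)).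
pose psi := fix f i := if i is i'.+1 then nx i (f i') else nx 0%N 0%N.
have psig i : good i (psi i) by case: i => [|i]; apply: (proj2 (nxP _ _)).
exists psi; split; first by move=> j; case: (nxP j.+1 (psi j)).
exists l => j; apply/cvgrPdist_le => e e0.
near=> n.
have jn : (j <= n)%N by near: n; exact: nbhs_infty_ge.
apply: (le_trans (psig n j jn)).
near: n.
by have /cvgrPdist_le /(_ e e0) := @cvg_harmonic R; apply: filterS => n /=;
  rewrite sub0r normrN ger0_norm.
Unshelve. all: by end_near. Qed.

Section FlowExistence.
Variables (R : realType) (lam : R) (d : nat).
Hypotheses (lam0 : 0 <= lam) (lam1 : lam <= 1).
Implicit Types (u : seqR R) (k : nat).

Local Notation F := (lcq_rhs lam d).
Local Notation L := (lipF R d).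
Local Notation is_flow := (@is_flow R lam d).

Lemma lipF_ge0 : 0 <= L.
Proof. by rewrite mulr_ge0 ?addr_ge0. Qed.

(** The offset [d.+1] gives [step m * (1 + d%:R) <= 1], the condition of [euler_Uset], for every
    [m]. *)
Let step m : R := (m + d.+1)%:R^-1.

Lemma step_gt0 m : 0 < step m.
Proof. by rewrite invr_gt0 ltr0n addnS. Qed.

Lemma step_le m : step m * (1 + d%:R) <= 1.
Proof.
rewrite mulrC ler_pdivrMr ?ltr0n ?addnS// mul1r -natr1 natrD.
by have : 0 <= m%:R :> R by []; lra.
Qed.

(** The interpolation is piecewise constant in time: each value is an Euler iterate and so lies in
    U, at the price of an error of one step length. *)
Definition polygon u m (t : R) : seqR R :=
  iter (Num.trunc (t / step m)) (euler R lam d (step m)) u.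

Lemma polygon_Uset u m t : Uset u -> Uset (polygon u m t).
Proof.
by move=> Uu; apply: euler_iter_Uset => //; [exact: ltW (step_gt0 m)|exact: step_le].
Qed.

(** The elapsed grid time differs from [h] by at most one step and the right-hand side is bounded by
    1, hence the two corrections by [step m]. *)
Lemma polygon_flow u m t h k : Uset u -> 0 <= t -> 0 <= h ->
  `|polygon u m (t + h) k.+1 - polygon u m t k.+1 - h * F (polygon u m t) k.+1|
    <= L * (h + step m) ^+ 2 + step m.
Proof.
move=> Uu t0 h0; have s0 := step_gt0 m; set s := step m in s0 *.
have js : 0 <= t / s by rewrite divr_ge0// ltW.
have jts : 0 <= (t + h) / s by rewrite divr_ge0 ?addr_ge0// ltW.
set j := Num.trunc (t / s); set j' := Num.trunc ((t + h) / s).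
have jj' : (j <= j')%N.
  by apply: le_truncn; rewrite ler_wpM2r ?invr_ge0 ?(ltW s0)//; lra.
have /andP[j1 j2] := truncn_itv js; have /andP[j3 j4] := truncn_itv jts.
have := euler_iter_lin R lam d lam0 lam1 s u (ltW s0) (step_le m) Uu j (j' - j) k.
rewrite subnK// -/(polygon u m (t + h)) -/(polygon u m t).
rewrite natrB//.
have e1 : `|(j'%:R - j%:R) * s - h| <= s.
  have : (t + h) / s * s = t + h by rewrite divfK// gt_eqF.
  have : t / s * s = t by rewrite divfK// gt_eqF.
  move: j1 j2 j3 j4; rewrite -/j -/j' -!natr1 ler_norml.
  set X := t / s; set Y := (t + h) / s => j1 j2 j3 j4 eX eY.
  have := ler_wpM2r (ltW s0) j1; have := ler_wpM2r (ltW s0) (ltW j2).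
  have := ler_wpM2r (ltW s0) j3; have := ler_wpM2r (ltW s0) (ltW j4).
  by rewrite !mulrDl eX eY; lra.
set x := (_ - _) * s in e1 * => hx.
have hF := lcq_rhs_le1 R lam d lam0 lam1 _ k (polygon_Uset u m t Uu).
set f := F _ _ in hx hF *.
have xf : `|(x - h) * f| <= s.
  by rewrite normrM -[leRHS]mulr1 ler_pM.
have x0 : 0 <= x by rewrite /x mulr_ge0 ?subr_ge0 ?ler_nat ?(ltW s0).
have xs : x <= h + s by move: e1; rewrite ler_norml; lra.
have : L * x ^+ 2 <= L * (h + s) ^+ 2.
  by rewrite ler_wpM2l ?lipF_ge0// lerXn2r ?nnegrE// addr_ge0// ltW.
by move: hx xf; rewrite !ler_norml; lra.
Qed.

(* A limit of Euler polygons along an ultrafilter exists pointwise by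
   compactness, so that no Cauchy estimate is needed. *)
Lemma flow_exists u : Uset u -> exists2 v : pathR R, is_flow v & v 0 = u.
Proof.
move=> Uu; have [G UG sG] := ultra_oo.
have p01 m t k : 0 <= polygon u m t k <= 1.
  have Up := polygon_Uset u m t Uu.
  by rewrite Uset_ge0// Uset_le1.
have /choice[v vP] (t : R) : exists w : seqR R,
    forall k, (fun m => polygon u m t k) @ G --> w k.
  have [w wP] := choice (fun k =>
    ultra_unit_cvg G (fun m => polygon u m t k) UG (fun m => p01 m t k)).
  by exists w.
have vU t : Uset (v t).
  split.
    have : (fun m => polygon u m t 0%N) @ G --> (1 : R).
      apply: cvg_near_cst; apply: filterS filterT => m _.
      by case: (polygon_Uset u m t Uu).
    by move=> /(cvg_unique _ (vP t 0%N)) -> .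
  split=> k; last by apply: (cvgr_to_ge (vP t k)); apply: filterS filterT => m _; case/andP: (p01 m t k).
  apply: (ler_cvg_to (vP t k.+1) (vP t k)); apply: filterS filterT => m _.
  exact/Uset_S/polygon_Uset.
exists v; last first.
  apply/funext => k; have : (fun m => polygon u m 0 k) @ G --> (u k : R).
    apply: cvg_near_cst; apply: filterS filterT => m _.
    by rewrite /polygon mul0r truncn0.
  by move=> /(cvg_unique _ (vP 0 k)) ->.
split=> // t h k t0 h0.
have l0 := lam0; have l1 := lam1; have L0 := lipF_ge0.
have d0 : 0 <= d%:R :> R by [].
(* All limits are replaced by one polygon at a common index. The constant collects 3 for two
   coordinates and the step length, [2 * h * (1 + d%:R)] for the right-hand side, and
   [L * (2 * h + 1)] for the square of [h + step m]. *)
apply: (@ler_addM_eps _ _ _ (3 + 2 * h * (1 + d%:R) + L * (2 * h + 1))).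
  by rewrite !addr_ge0 ?mulr_ge0// ?addr_ge0 ?mulr_ge0.
move=> e e0 e1.
have near_v s i : \forall m \near G, `|v s i - polygon u m s i| <= e.
  by have /cvgrPdist_le := vP s i; apply.
have near_s : \forall m \near G, step m <= e.
  apply: sG; have /cvgrPdist_le /(_ e e0) := @cvg_harmonic R.
  apply: filterS => m /=; rewrite sub0r normrN ger0_norm//.
  by apply: le_trans; rewrite lef_pV2 ?posrE ?ltr0n ?addnS// ler_nat ltnS leq_addr.
have [m [[[[ha hb] hc] hd] hs]] := filter_ex (filterI (filterI (filterI (filterI
  (near_v t k) (near_v t k.+1)) (near_v t k.+2)) (near_v (t + h) k.+1)) near_s).
have hp := polygon_flow u m t h k Uu t0 h0.
have hl := lcq_rhs_lip R lam d lam0 _ _ _ _ _ _ (vU t)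
  (polygon_Uset u m t Uu) ha hb hc.
have s0 := step_gt0 m.
have hF : `|h * (F (v t) k.+1 - F (polygon u m t) k.+1)| <= h * (2 * (1 + d%:R) * e).
  by rewrite normrM ger0_norm// ler_wpM2l// (le_trans hl)//; nra.
have hq : L * (h + step m) ^+ 2 <= L * h ^+ 2 + e * (L * (2 * h + 1)).
  rewrite [e * _]mulrCA -mulrDr ler_wpM2l//; set s := step m in s0 hs *; nra.
have q : h * (2 * (1 + d%:R) * e) = e * (2 * h * (1 + d%:R)) by ring.
move: hp hF hb hd; rewrite q !ler_norml; lra.
Qed.

End FlowExistence.

(** * Stability and regularity of the flow *)

Lemma rho_sym {R : realType} (u v : seqR R) : rho u v = rho v u.
Proof. by rewrite /rho; congr sup; apply: eq_imagel => k _; rewrite distrC. Qed.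

Lemma rho_triangle {R : realType} (u v w : seqR R) : Uset u -> Uset v -> Uset w ->
  rho u w <= rho u v + rho v w.
Proof.
move=> Uu Uv Uw; apply: rho_le => k k0.
rewrite ler_pdivrMr ?ltr0n// mulrC mulrDr.
apply: (le_trans (ler_distD (v k) _ _)).
by apply: lerD; exact: rho_ge.
Qed.

Lemma rho_ge0 {R : realType} (u v : seqR R) : Uset u -> Uset v -> 0 <= rho u v.
Proof.
move=> Uu Uv; have := rho_ge _ u v 1 Uu Uv isT.
by rewrite mul1r; apply: le_trans.
Qed.

Section FlowStability.
Variables (R : realType) (lam : R) (d : nat).
Hypotheses (lam0 : 0 <= lam) (lam1 : lam <= 1).
Implicit Types (u : seqR R) (k : nat).

Local Notation F := (lcq_rhs lam d).
Local Notation L := (lipF R d).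
Local Notation is_flow := (@is_flow R lam d).

Let K : R := 2 + 3 * d%:R.

(** [rho] divides coordinate [k] by [k], so the distance is carried in the form [k%:R * a]. Since
    [k + k.+1 <= 2 * k.+1] and [k.+1 + k.+2 <= 3 * k.+1], this form reproduces itself with the rate
    [K = 2 + 3 * d%:R]; each of the two solutions adds [L * h ^+ 2] per step. *)
Lemma flow_gronwall_step (v v' : pathR R) (D h : R) N k :
  is_flow v -> is_flow v' -> 0 <= D -> 0 <= h ->
  (forall k, `|v 0 k - v' 0 k| <= k%:R * D) ->
  `|v (N%:R * h) k - v' (N%:R * h) k| <=
     k%:R * ((D + N%:R * (2 * L * h ^+ 2)) * (1 + K * h) ^+ N).
Proof.
move=> [vU vF] [v'U v'F] D0 h0 H0.
have L0 : 0 <= L by exact: lipF_ge0.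
have d0 : 0 <= d%:R :> R by [].
have K0 : 0 <= K * h by rewrite mulr_ge0// /K; lra.
elim: N k => [|N IH] k; first by rewrite !mul0r expr0 mulr1 addr0.
have t0 : 0 <= N%:R * h by rewrite mulr_ge0.
case: k => [|k].
  have [-> _] := vU _ (mulr_ge0 (ler0n _ N.+1) h0).
  have [-> _] := v'U _ (mulr_ge0 (ler0n _ N.+1) h0).
  by rewrite subrr normr0 mul0r.
rewrite -natr1 mulrDl mul1r.
have f1 := vF _ h k t0 h0; have f2 := v'F _ h k t0 h0.
set a := (D + N%:R * _) * _ in IH.
have a0 : 0 <= a.
  apply: mulr_ge0; last by rewrite exprn_ge0// addr_ge0.
  by rewrite addr_ge0// !mulr_ge0// exprn_ge0.
have f3 := lcq_rhs_lip R lam d lam0 _ _ k _ _ _ (vU _ t0) (v'U _ t0)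
   (IH k) (IH k.+1) (IH k.+2).
have f4 : `|h * (F (v (N%:R * h)) k.+1 - F (v' (N%:R * h)) k.+1)| <=
    h * (k.+1%:R * K * a).
  rewrite normrM ger0_norm// ler_wpM2l// (le_trans f3)//.
  rewrite (_ : k.+1%:R * K * a =
      (2 * k.+1%:R) * a + d%:R * (3 * k.+1%:R * a)); last by rewrite /K; ring.
  have ka : 0 <= k%:R * a by rewrite mulr_ge0.
  apply: lerD.
    apply: (@le_trans _ _ (1 * (k%:R * a + k.+1%:R * a))).
      by rewrite ler_wpM2r// addr_ge0//; apply: mulr_ge0.
    by rewrite -natr1; nra.
  by rewrite ler_wpM2l// -[k.+2%:R]natr1 -natr1; nra.
have f5 := IH k.+1.
have kk : 1 <= k.+1%:R :> R by rewrite ler1n.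
set c := 2 * L * h ^+ 2; have c0 : 0 <= c by rewrite !mulr_ge0 ?exprn_ge0.
have E1 : 1 <= (1 + K * h) ^+ N.+1 by rewrite exprn_ege1//; lra.
have f6 : k.+1%:R * (a * (1 + K * h) + c) <=
    k.+1%:R * ((D + (N%:R + 1) * c) * (1 + K * h) ^+ N.+1).
  have -> : (D + (N%:R + 1) * c) * (1 + K * h) ^+ N.+1 =
      a * (1 + K * h) + c * (1 + K * h) ^+ N.+1.
    by rewrite exprSr /a /c; ring.
  by rewrite ler_wpM2l// lerD2l ler_peMr.
apply: le_trans f6.
have e1 : c = L * h ^+ 2 + L * h ^+ 2 by rewrite /c; ring.
have e2 : k.+1%:R * (a * (1 + K * h) + c) =
   k.+1%:R * a + h * (k.+1%:R * K * a) + k.+1%:R * c by ring.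
have e3 : c <= k.+1%:R * c by rewrite ler_peMl.
by move: f1 f2 f4 f5; rewrite e2 !ler_norml; lra.
Qed.

(** With [N] steps of length [t / N] the accumulated Taylor errors are of order [1 / N], and the
    growth factor is at most [expR (K * t)]. *)
Lemma flow_gronwall (v v' : pathR R) (D t : R) k :
  is_flow v -> is_flow v' -> 0 <= D -> 0 <= t ->
  (forall k, `|v 0 k - v' 0 k| <= k%:R * D) ->
  `|v t k - v' t k| <= k%:R * (D * expR (K * t)).
Proof.
move=> fv fv' D0 t0 H0; have L0 : 0 <= L by exact: lipF_ge0.
have K0 : 0 <= K * t by rewrite mulr_ge0 ?addr_ge0.
apply: (@ler_addM_eps _ _ _ (k%:R * (2 * L * t ^+ 2 * expR (K * t)))).
  by rewrite !mulr_ge0 ?exprn_ge0 ?expR_ge0.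
move=> e e0 e1; pose N := (Num.trunc e^-1).+1.
have N0 : 0 < N%:R :> R by rewrite ltr0n.
have Ne : N%:R^-1 <= e.
  by rewrite -[leRHS]invrK lef_pV2 ?posrE ?invr_gt0// ltW// truncnS_gt.
have := flow_gronwall_step v v' D (t / N%:R) N k fv fv' D0
  (divr_ge0 t0 (ltW N0)) H0.
rewrite [N%:R * (t / _)]mulrC divfK ?gt_eqF// => /le_trans; apply.
rewrite [e * _]mulrCA -mulrDr ler_wpM2l// [e * _]mulrA -mulrDl.
have -> : N%:R * (2 * L * (t / N%:R) ^+ 2) = N%:R^-1 * (2 * L * t ^+ 2).
  by field; rewrite gt_eqF.
apply: ler_pM.
- by rewrite addr_ge0// !mulr_ge0 ?exprn_ge0 ?invr_ge0// ltW.
- by rewrite exprn_ge0// addr_ge0// mulrA divr_ge0// ltW.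
- by rewrite lerD2l ler_wpM2r// !mulr_ge0 ?exprn_ge0.
- have -> : K * t = N%:R * (K * (t / N%:R)) by field; rewrite gt_eqF.
  rewrite expRM_natl lerXn2r ?nnegrE ?expR_ge0 ?expR_ge1Dx//.
  by rewrite addr_ge0// mulrA divr_ge0// ltW.
Qed.

Lemma flow_speed (v : pathR R) t h k : is_flow v -> 0 <= t -> 0 <= h -> h <= 1 ->
  `|v (t + h) k - v t k| <= (1 + L) * h.
Proof.
move=> [vU vF] t0 h0 h1; have L0 : 0 <= L by exact: lipF_ge0.
case: k => [|k].
  have [-> _] := vU _ t0; have [-> _] := vU _ (addr_ge0 t0 h0).
  by rewrite subrr normr0 mulr_ge0// addr_ge0.
have f1 := vF t h k t0 h0.
have f2 : `|h * F (v t) k.+1| <= h.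
  by rewrite normrM ger0_norm// ler_piMr// lcq_rhs_le1//; exact: vU.
have f3 : L * h ^+ 2 <= L * h by rewrite ler_wpM2l// expr2 ler_piMr.
by move: f1 f2; rewrite !ler_norml; lra.
Qed.

(** [is_flow] only looks forward. The backward estimate, which a two-sided derivative requires,
    follows by starting at [t - h] and comparing the right-hand sides at both ends. *)
Lemma flow_left (v : pathR R) t h k : is_flow v -> 0 <= h -> h <= 1 -> h <= t ->
  `|v t k.+1 - v (t - h) k.+1 - h * F (v t) k.+1| <= (L + L * (1 + L)) * h ^+ 2.
Proof.
move=> fv h0 h1 ht; have [vU vF] := fv; have L0 : 0 <= L by exact: lipF_ge0.
have l0 := lam0; have l1 := lam1.
have d0 : 0 <= d%:R :> R by [].
have s0 : 0 <= t - h by lra.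
have t0 : 0 <= t by lra.
have f1 := vF (t - h) h k s0 h0; rewrite subrK in f1.
have f2 i : `|v t i - v (t - h) i| <= (1 + L) * h.
  by have := flow_speed v (t - h) h i fv s0 h0 h1; rewrite subrK.
have f3 := lcq_rhs_lip R lam d lam0 _ _ k _ _ _ (vU _ t0) (vU _ s0)
   (f2 k) (f2 k.+1) (f2 k.+2).
set b := (1 + L) * h in f3; have b0 : 0 <= b by rewrite mulr_ge0// addr_ge0.
have f4 : `|h * (F (v t) k.+1 - F (v (t - h)) k.+1)| <= h * (L * b).
  rewrite normrM ger0_norm// ler_wpM2l// (le_trans f3)// /lipF; nra.
have e : (L + L * (1 + L)) * h ^+ 2 = L * h ^+ 2 + h * (L * b) by rewrite /b; ring.
by move: f1 f4; rewrite e !ler_norml; lra.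
Qed.

Lemma flow_rho (v : pathR R) s t : is_flow v -> 0 <= s -> 0 <= t ->
  `|s - t| <= 1 -> rho (v s) (v t) <= (1 + L) * `|s - t|.
Proof.
move=> fv; have L0 : 0 <= L by exact: lipF_ge0.
wlog st : s t / s <= t => [hw|] s0 t0 st1.
  have [?|/ltW st] := leP s t; first exact: hw.
  by rewrite rho_sym distrC; apply: hw => //; rewrite distrC.
apply: rho_le => k k0; rewrite ler_pdivrMr ?ltr0n//.
have k1 : 1 <= k%:R :> R by rewrite ler1n.
move: st1; rewrite distrC ger0_norm ?subr_ge0// => st1.
have := flow_speed v s (t - s) k fv s0; rewrite subr_ge0 => /(_ st st1).
rewrite [s + _]addrC subrK distrC => /le_trans; apply.
by rewrite ler_peMr// mulr_ge0 ?subr_ge0// addr_ge0.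
Qed.

Lemma flow_cadlag (v : pathR R) : is_flow v -> cadlag v.
Proof.
move=> fv; have [vU vF] := fv; have L0 : 0 <= L by exact: lipF_ge0.
have L1 : 0 < 1 + L by lra.
have key t e : 0 <= t -> 0 < e -> exists2 del, 0 < del &
   forall s, 0 <= s -> `|s - t| < del -> rho (v s) (v t) < e.
  move=> t0 e0; exists (Num.min 1 (e / (1 + L))).
    by rewrite lt_min ltr01 divr_gt0.
  move=> s s0; rewrite lt_min => /andP[/ltW st1 st].
  by apply: (le_lt_trans (flow_rho v s t fv s0 t0 st1)); rewrite mulrC -ltr_pdivlMr.
split=> //; split=> [t t0 e e0|t t0].
  have [del del0 h] := key t e t0 e0; exists del => // s ts sd.
  by apply: h; [exact: le_trans ts|rewrite ger0_norm ?subr_ge0//; lra].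
exists (v t); first exact/vU/ltW.
move=> e e0; have [del del0 h] := key t e (ltW t0) e0; exists del => // s s0 ds st.
by apply: h => //; rewrite ltr_norml; lra.
Qed.

Lemma flow_derive (v : pathR R) k (t : R) : is_flow v -> 0 < t ->
  is_derive t 1 (fun s => v s k.+1) (F (v t) k.+1).
Proof.
move=> fv t0; have [vU vF] := fv; have L0 : 0 <= L by exact: lipF_ge0.
pose C := L + L * (1 + L).
have C0 : 0 <= C by rewrite /C !addr_ge0 ?mulr_ge0 ?addr_ge0.
suff h : (fun h : R => h^-1 *: ((v (h *: 1 + t) k.+1 : R) - v t k.+1)) @ 0^'
    --> F (v t) k.+1.
  by apply: DeriveDef; [apply/cvg_ex; exists (F (v t) k.+1)|exact: cvg_lim h].
apply/cvgrPdist_le => e e0; near=> h => /=.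
have h0 : h != 0 by near: h; exact: nbhs_dnbhs_neq.
have hn0 : 0 < `|h| by rewrite normr_gt0.
have /andP[h1 ht] : (`|h| <= 1) && (`|h| <= t).
  near: h; apply: nbhs_dnbhs; exists (Num.min 1 t) => /=.
    by rewrite lt_min ltr01.
  by move=> x /=; rewrite sub0r normrN lt_min => /andP[/ltW -> /ltW ->].
have he : C * `|h| <= e.
  near: h; apply: nbhs_dnbhs; exists (e / (C + 1)) => /=.
    by rewrite divr_gt0//; lra.
  move=> x /=; rewrite sub0r normrN ltr_pdivlMr; last lra.
  by have : 0 <= `|x| by []; nra.
rewrite [h *: 1]mulr1 distrC.
have -> : h^-1 *: (v (h + t) k.+1 - v t k.+1) - F (v t) k.+1 =
    h^-1 * (v (h + t) k.+1 - v t k.+1 - h * F (v t) k.+1).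
  by rewrite [in RHS]mulrBr mulKf.
rewrite normrM normfV mulrC ler_pdivrMr//.
apply: (@le_trans _ _ (C * `|h| ^+ 2)); last first.
  by rewrite expr2 mulrA ler_wpM2r// ltW.
have [hp|hn] := leP 0 h.
  rewrite (ger0_norm hp) [h + t]addrC (le_trans (vF _ _ _ (ltW t0) hp))//.
  by rewrite ler_wpM2r ?exprn_ge0// /C lerDl mulr_ge0// addr_ge0.
have := flow_left v t `|h| k fv (ltW hn0) h1 ht.
rewrite (ltr0_norm hn) opprK [t + h]addrC => hh.
rewrite -normrN; move: hh; rewrite -/C.
by rewrite !opprB mulNr opprK addrA [h * _ + _]addrC addrAC.
Unshelve. all: by end_near. Qed.

Lemma flow_derive0 (v : pathR R) k : is_flow v ->
  (fun h : R => h^-1 * (v h k.+1 - v 0 k.+1)) @ 0^'+ --> F (v 0) k.+1.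
Proof.
move=> fv; have [vU vF] := fv; have L0 : 0 <= L by exact: lipF_ge0.
apply/cvgrPdist_le => e e0; near=> h.
have h0 : 0 < h by near: h; exact: nbhs_right_gt.
have he : L * h <= e.
  have : h <= e / (L + 1).
    near: h; apply: nbhs_right_le; rewrite divr_gt0//; lra.
  by rewrite ler_pdivlMr; [nra|lra].
rewrite distrC.
have -> : h^-1 * (v h k.+1 - v 0 k.+1) - F (v 0) k.+1 =
    h^-1 * (v h k.+1 - v 0 k.+1 - h * F (v 0) k.+1).
  by field; rewrite gt_eqF.
have := vF 0 h k (lexx 0) (ltW h0); rewrite add0r => hh.
rewrite normrM normfV (gtr0_norm h0) mulrC ler_pdivrMr//.
apply: (le_trans hh).
by rewrite expr2 mulrA ler_wpM2r// ltW.
Unshelve. all: by end_near. Qed.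

(** A choice of solution for each initial state in U; the constant path is a default value.
    Continuous dependence on [u] is [flow_rho_le]. *)
Definition flow u : pathR R := xget (fun=> u) [set v | is_flow v /\ v 0 = u].

Lemma flowP u : Uset u -> is_flow (flow u) /\ flow u 0 = u.
Proof.
move=> Uu; have [v fv v0] := flow_exists R lam d lam0 lam1 u Uu.
by rewrite /flow; case: xgetP => [w -> []//|/(_ v)]; case.
Qed.

Lemma flow_Uset u t : Uset u -> 0 <= t -> Uset (flow u t).
Proof. by move=> /flowP[[+ _] _]; apply. Qed.

Lemma flow_rho_le u u' t : Uset u -> Uset u' -> 0 <= t ->
  rho (flow u t) (flow u' t) <= rho u u' * expR (K * t).
Proof.
move=> Uu Uu' t0; have [fu u0] := flowP u Uu; have [fu' u'0] := flowP u' Uu'.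
apply: rho_le => k k0; rewrite ler_pdivrMr ?ltr0n// mulrC.
apply: flow_gronwall => //; first exact: rho_ge0.
case=> [|i]; last by rewrite u0 u'0 rho_ge.
by rewrite u0 u'0; case: Uu => -> _; case: Uu' => -> _; rewrite subrr normr0 mul0r.
Qed.

Lemma sk_conv_uniform (xs : nat -> pathR R) x :
  (forall T, 0 < T -> forall e, 0 < e -> exists N, forall n, (N <= n)%N ->
     forall t, 0 <= t -> t <= T -> rho (xs n t) (x t) < e) -> sk_conv xs x.
Proof.
move=> h; exists (fun=> id); split=> [_|T T0 e e0].
  split=> //; split=> //; split; first by move=> y y0; exists y.
  by move=> t t0 e e0; exists e.
have [N hN] := h T T0 e e0; exists N => n Nn t t0 tT.
by rewrite subrr normr0; split=> //; exact: hN.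
Qed.

(** All Skorokhod convergence used later comes from here. The triangle inequality through
    [flow (us n)] leaves a distance of two flow lines, which [flow_rho_le] bounds by that of their
    initial states. *)
Lemma sk_conv_flow (xs : nat -> pathR R) (us : nat -> seqR R) u :
  (forall n, cadlag (xs n)) -> (forall n, Uset (us n)) -> Uset u ->
  (forall k, (fun n => us n k) @ \oo --> u k) ->
  (forall T e, 0 < e -> exists N, forall n, (N <= n)%N ->
     forall t, 0 <= t -> t <= T -> rho (xs n t) (flow (us n) t) <= e) ->
  sk_conv xs (flow u).
Proof.
move=> cx Uus Uu usu hx; apply: sk_conv_uniform => T T0 e e0.
have [N1 hN1] := hx T (e / 3) (divr_gt0 e0 (ltr0n R 3)).
pose E := expR (K * T); have E0 : 0 < E by exact: expR_gt0.
pose e' := e / 3 / E; have e'0 : 0 < e' by rewrite !divr_gt0.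
pose M := (Num.trunc e'^-1).+1.
have Me : M%:R^-1 <= e'.
  by rewrite -[leRHS]invrK lef_pV2 ?posrE ?invr_gt0// ltW// truncnS_gt.
have [N2 _ hN2] : \forall n \near \oo, forall k : 'I_M.+1, `|u k - us n k| <= e'.
  by apply: filter_forall => k; have /cvgrPdist_le := usu k; apply.
exists (maxn N1 N2) => n; rewrite geq_max => /andP[n1 n2] t t0 tT.
have Ut := (flow_Uset _ _ (Uus n) t0).
apply: (le_lt_trans (rho_triangle _ (flow (us n) t) _ _ _ _)) => //.
- by case: (cx n) => + _; apply.
- exact: flow_Uset.
have r1 := hN1 n n1 t t0 tT.
have r2 := flow_rho_le (us n) u t (Uus n) Uu t0.
have r3 : rho (us n) u <= e'.
  apply: (@rho_le_coord _ _ _ _ M) => //; first exact: ltW.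
  move=> k kM; rewrite distrC.
  exact: (hN2 n n2 (Ordinal (kM : (k < M.+1)%N))).
have r4 : rho (flow (us n) t) (flow u t) <= e' * E.
  apply: (le_trans r2); apply: ler_pM => //; first exact: rho_ge0.
  by rewrite ler_expR ler_wpM2l// addr_ge0.
have : e' * E = e / 3 by rewrite divfK// gt_eqF.
lra.
Qed.

End FlowStability.

(** * The uniformized kernel *)

Lemma series_sum_finite {R : realType} (a : nat -> R) K :
  (forall k, (K <= k)%N -> a k = 0) -> series_sum a = \sum_(k < K) a k.
Proof.
move=> a0; rewrite /series_sum; apply: lim_near_cst => //.
near=> n; have Kn : (K <= n)%N by near: n; exact: nbhs_infty_ge.
rewrite /series /= (@big_cat_nat _ _ _ K)//= big_mkord.
rewrite [X in _ + X]big_nat_cond [X in _ + X]big1 ?addr0//.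
by move=> k /andP[/andP[Kk _] _]; exact: a0.
Unshelve. all: by end_near. Qed.

Section Kernel.
Variables (R : realType) (n : nat) (lam q : R) (d : nat).
Hypotheses (n0 : (0 < n)%N) (lam0 : 0 <= lam) (q0 : 0 < q) (q1 : q <= 1).
Implicit Types (x y : seqR R) (k j : nat).

Local Notation up := (upK lam).
Local Notation dn := (dnK n lam q d).
Local Notation diag := (diagK n lam q d).
Local Notation Kp := (Kpow n lam q d).
Local Notation sp x k := (Defs.shift x k n%:R^-1).
Local Notation sm x k := (Defs.shift x k (- n%:R^-1)).

Lemma alpha_01 : 0 <= alpha n q <= 1.
Proof.
rewrite /alpha; have q0' := q0; have q1' := q1.
have h0 : 0 <= (1 - q) ^+ n by rewrite exprn_ge0//; lra.
have h1 : (1 - q) ^+ n <= 1 by rewrite exprn_ile1//; lra.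
by lra.
Qed.

Lemma upK_ge0 x k : Uset x -> 0 <= up x k.
Proof.
move=> Ux; rewrite /upK divr_ge0// ?addr_ge0// mulr_ge0// subr_ge0.
exact: Uset_S.
Qed.

Lemma dnK_ge0 x k : Uset x -> 0 <= dn x k.
Proof.
move=> Ux; rewrite /dnK divr_ge0// ?addr_ge0// mulr_ge0//.
  by case/andP: alpha_01.
by case/andP: (Uset_powD _ x k.+1 d Ux).
Qed.

Lemma upK_supp x K : (forall k, (K <= k)%N -> x k = 0) ->
  forall k, (K <= k)%N -> up x k = 0.
Proof. by move=> h k Kk; rewrite /upK !h ?subrr ?mulr0 ?mul0r// leqW. Qed.

Lemma dnK_supp x K : (forall k, (K <= k)%N -> x k = 0) ->
  forall k, (K <= k)%N -> dn x k = 0.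
Proof.
by move=> h k Kk; rewrite /dnK !h ?subrr ?mulr0 ?mul0r// ?leqW.
Qed.

(** Both sums telescope, the arrivals to at most [lam] and the departures to at most 1; the
    uniformization rate [n * (lam + 1)] thus leaves a nonnegative diagonal. *)
Lemma sum_upK_dnK_le1 x K : Uset x -> \sum_(k < K) (up x k + dn x k) <= 1.
Proof.
move=> Ux; have l0 := lam0; have l1 : 0 < lam + 1 by lra.
have -> : \sum_(k < K) (up x k + dn x k) =
  (lam * (x 0%N - x K) + alpha n q * ((1 - x K.+1) ^+ d - (1 - x 1%N) ^+ d))
    / (lam + 1).
  elim: K => [|K IH]; first by rewrite big_ord0 !subrr !mulr0 addr0 mul0r.
  by rewrite big_ord_recr /= IH /upK /dnK; field; rewrite gt_eqF.
rewrite ler_pdivrMr// mul1r lerD//.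
  rewrite ler_piMr//; have := Uset_ge0 _ x K Ux; case: Ux => -> _; lra.
have /andP[a0 a1] := alpha_01.
have /andP[_ p1] := Uset_pow _ x K.+1 d Ux.
have /andP[p0 _] := Uset_pow _ x 1 d Ux.
have [s0|s0] := leP 0 ((1 - x K.+1) ^+ d - (1 - x 1%N) ^+ d).
  by rewrite mulr_ile1//; lra.
by apply: (@le_trans _ _ 0) => //; rewrite mulr_ge0_le0// ltW.
Qed.

Lemma diagK_finite x K : (forall k, (K <= k)%N -> x k = 0) ->
  diag x = 1 - \sum_(k < K) (up x k + dn x k).
Proof.
move=> h; rewrite /diagK (@series_sum_finite _ _ K)// => k Kk.
by rewrite (upK_supp x K)// (dnK_supp x K)// addr0.
Qed.

Lemma diagK_ge0 x : Sn n x -> 0 <= diag x.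
Proof.
move=> [Ux [_ [K h]]]; rewrite (diagK_finite x K)// subr_ge0.
exact: sum_upK_dnK_le1.
Qed.

Lemma Sn_gap x k : Sn n x -> x k.+1 != x k -> x k.+1 + n%:R^-1 <= x k.
Proof.
move=> [Ux [xn _]] neq; have nR : 0 < n%:R :> R by rewrite ltr0n.
have [m1 e1] := xn k; have [m2 e2] := xn k.+1.
have xk : x k.+1 < x k by rewrite lt_neqAle neq Uset_S.
rewrite -(ler_pM2l nR) mulrDr divff ?gt_eqF// e1 e2 natr1 ler_nat.
by rewrite -(ltr_nat R) -e1 -e2 ltr_pM2l.
Qed.

(** A nonzero rate forces [x k.+1 < x k], and between multiples of [n%:R^-1] this leaves room for a
    full jump. *)
Lemma shift_up_Sn x k : Sn n x -> up x k != 0 -> Sn n (sp x k).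
Proof.
move=> Sx upn0; have nR : 0 < n%:R :> R by rewrite ltr0n.
have ni : 0 <= n%:R^-1 :> R by rewrite invr_ge0.
have neq : x k.+1 != x k.
  apply: contra upn0 => /eqP e; by rewrite /upK e subrr mulr0 mul0r.
have gap := Sn_gap x k Sx neq; have [Ux [xn [K hK]]] := Sx.
rewrite /Defs.shift; split.
  split; first by case: Ux.
  split=> i.
    case: (eqVneq i.+1 k.+1) => [[->]|ik].
      by rewrite ltn_eqF//.
    case: eqP => [_|_]; last exact: Uset_S.
    by have := Uset_S _ x i Ux; lra.
  by have := Uset_ge0 _ x i Ux; case: eqP => _ //; lra.
split.
  move=> i; have [m e] := xn i; case: eqP => _; last by exists m.
  by exists m.+1; rewrite mulrDr divff ?gt_eqF// e natr1.
exists (maxn K k.+2) => i; rewrite geq_max => /andP[Ki ki].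
by rewrite gtn_eqF// hK.
Qed.

Lemma shift_dn_Sn x k : Sn n x -> dn x k != 0 -> Sn n (sm x k).
Proof.
move=> Sx dnn0; have nR : 0 < n%:R :> R by rewrite ltr0n.
have ni : 0 <= n%:R^-1 :> R by rewrite invr_ge0.
have neq : x k.+2 != x k.+1.
  apply: contra dnn0 => /eqP e; by rewrite /dnK e subrr mulr0 mul0r.
have gap := Sn_gap x k.+1 Sx neq; have [Ux [xn [K hK]]] := Sx.
rewrite /Defs.shift; split.
  split; first by case: Ux.
  split=> i.
    case: (eqVneq i.+1 k.+1) => [[->]|ik].
      by rewrite ltn_eqF//; have := Uset_S _ x k Ux; lra.
    case: eqP => [->|_]; last exact: Uset_S.
    lra.
  case: eqP => [->|_]; last exact: Uset_ge0.
  have := Uset_ge0 _ x k.+2 Ux; lra.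
split.
  move=> i; have [m e] := xn i; case: eqP => ik; last by exists m.
  have m0 : (0 < m)%N.
    rewrite -(ltr_nat R) -e ik mulr_gt0//.
    have := Uset_ge0 _ x k.+2 Ux; have : 0 < n%:R^-1 :> R by rewrite invr_gt0.
    lra.
  by exists m.-1; rewrite mulrBr divff ?gt_eqF// e -[in LHS](prednK m0) -natr1 addrK.
exists (maxn K k.+2) => i; rewrite geq_max => /andP[Ki ki].
by rewrite gtn_eqF// hK.
Qed.

(** The embedded jump kernel applied to [phi], with its series cut at a bound [K] for the support of
    [x]. *)
Definition Kavg x K (phi : seqR R -> R) : R :=
  diag x * phi x + \sum_(k < K) (up x k * phi (sp x k) + dn x k * phi (sm x k)).

Lemma KpowS x y K j : (forall k, (K <= k)%N -> x k = 0) ->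
  Kp j.+1 x y = Kavg x K (fun z => Kp j z y).
Proof.
move=> h; rewrite /Kavg /= (@series_sum_finite _ _ K)// => k Kk.
by rewrite (upK_supp x K)// (dnK_supp x K)// !mul0r addr0.
Qed.

Lemma Kavg_01 x K (phi : seqR R -> R) (M : R) : Sn n x ->
  (forall k, (K <= k)%N -> x k = 0) -> (forall z, Sn n z -> 0 <= phi z <= M) ->
  0 <= Kavg x K phi <= M.
Proof.
move=> Sx h phi01; have Ux := Sx.1.
have U k : 0 <= up x k * phi (sp x k) <= up x k * M.
  have := upK_ge0 x k Ux; have [->|u0 ?] := eqVneq (up x k) 0.
    by rewrite !mul0r lexx.
  have /andP[p0 p1] := phi01 _ (shift_up_Sn x k Sx u0).
  by rewrite mulr_ge0//= ler_wpM2l.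
have D k : 0 <= dn x k * phi (sm x k) <= dn x k * M.
  have := dnK_ge0 x k Ux; have [->|u0 ?] := eqVneq (dn x k) 0.
    by rewrite !mul0r lexx.
  have /andP[p0 p1] := phi01 _ (shift_dn_Sn x k Sx u0).
  by rewrite mulr_ge0//= ler_wpM2l.
have g0 := diagK_ge0 x Sx; have /andP[p0 p1] := phi01 _ Sx.
apply/andP; split.
  rewrite /Kavg addr_ge0 ?mulr_ge0// sumr_ge0// => k _.
  by rewrite addr_ge0//; [case/andP: (U k)|case/andP: (D k)].
have -> : M = diag x * M + \sum_(k < K) (up x k * M + dn x k * M).
  under eq_bigr do rewrite -mulrDl.
  by rewrite -mulr_suml -mulrDl (diagK_finite x K)// subrK mul1r.
rewrite lerD// ?ler_wpM2l//; apply: ler_sum => k _.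
by rewrite lerD//; [case/andP: (U k)|case/andP: (D k)].
Qed.

Lemma Kpow_01 j x y : Sn n x -> 0 <= Kp j x y <= 1.
Proof.
elim: j x => [|j IH] x Sx; first by rewrite /=; case: asboolP; rewrite ?ler01 ?lexx.
have [_ [_ [K h]]] := Sx; rewrite (KpowS x y K j h).
by apply: Kavg_01 => // z Sz; exact: IH.
Qed.

(** The terms for no jump and one jump are kept and the nonnegative rest is dropped. Comparison with
    the exponential series gives convergence, so that the partial sums stay below the limit. *)
Lemma ptrans_ge t x y : 0 <= t -> Sn n x ->
  expR (- (n%:R * (lam + 1) * t)) *
    (Kp 0 x y + n%:R * (lam + 1) * t * Kp 1 x y) <= ptrans n lam q d t x y.
Proof.
move=> t0 Sx; rewrite /ptrans; set th := n%:R * (lam + 1) * t.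
have th0 : 0 <= th by rewrite !mulr_ge0// addr_ge0.
rewrite /series_sum; set a := (fun j => _).
have a0 j : 0 <= a j.
  rewrite /a mulr_ge0//; last by case/andP: (Kpow_01 j x y Sx).
  by rewrite divr_ge0// mulr_ge0 ?expR_ge0 ?exprn_ge0.
have ca : cvgn (series a).
  apply: (@series_le_cvg _ _ (fun j => exp_coeff th j)) => // [j|j|].
  - by rewrite /exp_coeff divr_ge0// exprn_ge0.
  - have /andP[k0 k1] := Kpow_01 j x y Sx.
    rewrite /a /exp_coeff.
    apply: (@le_trans _ _ (expR (- th) * th ^+ j / j`!%:R)).
      by rewrite ler_piMr// divr_ge0// mulr_ge0 ?expR_ge0 ?exprn_ge0.
    rewrite ler_wpM2r ?invr_ge0// ler_piMl ?exprn_ge0//.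
    by rewrite -expR0 ler_expR oppr_le0.
  - exact: is_cvg_series_exp_coeff.
have nd : nondecreasing_seq (series a).
  by apply/nondecreasing_seqP => j; rewrite /series /= big_nat_recr//= lerDl.
have e2 : series a 2 = a 0%N + a 1%N.
  by rewrite /series /= !big_nat_recr//= big_nil add0r.
have := nondecreasing_cvgn_le nd ca 2; rewrite e2; apply: le_trans.
rewrite le_eqVlt; apply/orP; left; apply/eqP.
rewrite /a fact0 factS fact0 muln1 invr1 expr0 expr1.
by move: (Kp 0%N x y) (Kp 1%N x y) => k0 k1; ring.
Qed.

End Kernel.

(** * One-step estimates *)

Section OneStep.
Variables (R : realType) (n : nat) (lam q : R) (d : nat).
Hypotheses (n0 : (0 < n)%N) (lam0 : 0 <= lam) (lam1 : lam <= 1).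
Hypotheses (q0 : 0 < q) (q1 : q <= 1).
Implicit Types (x y z : seqR R) (k j : nat).

Local Notation up := (upK lam).
Local Notation dn := (dnK n lam q d).
Local Notation diag := (diagK n lam q d).
Local Notation Kp := (Kpow n lam q d).
Local Notation p := (ptrans n lam q d).
Local Notation sp x k := (Defs.shift x k n%:R^-1).
Local Notation sm x k := (Defs.shift x k (- n%:R^-1)).
Local Notation avg := (Kavg R n lam q d).
Local Notation F := (lcq_rhs lam d).
Local Notation L := (lipF R d).

(** The list contains every state reachable from [x] by at most one jump; [undup] makes each state
    count once in the sums over it. *)
Definition succs x K : seq (seqR R) :=
  undup (x :: [seq sp x k | k <- iota 0 K] ++ [seq sm x k | k <- iota 0 K]).

Lemma sum_indicator (s : seq (seqR R)) (c : seqR R -> R) z : uniq s -> z \in s ->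
  \sum_(y <- s) c y * (if `[< z = y >] then 1 else 0) = c z.
Proof.
move=> us zs; rewrite (bigD1_seq z)//= big1 ?addr0; last first.
  by move=> y yz; case: asboolP => [e|]; [rewrite e eqxx in yz|rewrite mulr0].
by case: asboolP => //; rewrite mulr1.
Qed.

Lemma Kavg_sum (s : seq (seqR R)) (c : seqR R -> R) (phi : seqR R -> seqR R -> R) x K :
  \sum_(y <- s) c y * avg x K (phi^~ y) = avg x K (fun z => \sum_(y <- s) c y * phi z y).
Proof.
rewrite /Kavg; under eq_bigr do rewrite mulrDr mulrCA.
rewrite big_split /= -mulr_sumr; congr (_ + _).
under eq_bigr do rewrite mulr_sumr.
rewrite exchange_big /=; apply: eq_bigr => k _.
rewrite !mulr_sumr -big_split /=; apply: eq_bigr => y _; ring.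
Qed.

Lemma ptrans_succs x K (c : seqR R -> R) dl : Sn n x ->
  (forall k, (K <= k)%N -> x k = 0) -> 0 <= dl -> (forall z, 0 <= c z) ->
  expR (- (n%:R * (lam + 1) * dl)) * (c x + n%:R * (lam + 1) * dl * avg x K c)
    <= \sum_(y <- succs x K) c y * p dl x y.
Proof.
move=> Sx hK dl0 c0; set th := n%:R * _ * _.
have us : uniq (succs x K) by exact: undup_uniq.
apply: (@le_trans _ _ (\sum_(y <- succs x K)
    c y * (expR (- th) * (Kp 0 x y + th * Kp 1 x y)))); last first.
  by apply: ler_sum => y _; rewrite ler_wpM2l// ptrans_ge.
under eq_bigr do rewrite mulrCA mulrDr [_ * (th * _)]mulrCA.
rewrite -mulr_sumr big_split /= -mulr_sumr.
rewrite (_ : \sum_(i <- _) c i * (if _ then _ else _) = c x); last first.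
  by rewrite sum_indicator// mem_undup inE eqxx.
rewrite (_ : \sum_(y <- succs x K) _ = avg x K c)//.
transitivity (\sum_(y <- succs x K) c y * avg x K (fun z => Kp 0 z y)).
  by apply: eq_bigr => y _; rewrite -(@KpowS _ _ _ _ _ _ _ K 0%N).
rewrite (@Kavg_sum _ _ (fun z y => Kp 0 z y)) /Kavg /=.
rewrite sum_indicator ?mem_undup ?inE ?eqxx//; congr (_ + _).
apply: eq_bigr => k _; congr (_ * _ + _ * _).
  rewrite sum_indicator// mem_undup inE mem_cat; apply/orP; right.
  by apply/orP; left; apply/mapP; exists (k : nat) => //; rewrite mem_iota ltn_ord.
rewrite sum_indicator// mem_undup inE mem_cat; apply/orP; right.
by apply/orP; right; apply/mapP; exists (k : nat) => //; rewrite mem_iota ltn_ord.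
Qed.

(* States outside [Sn n] are never visited, but [g] is only controlled on
   [Sn n]; the complementary cost is therefore cut off there. *)
Definition comp_cost (M : R) (g : seqR R -> R) z := if `[< Sn n z >] then M - g z else 0.

Lemma Kavg_comp_cost x K (g : seqR R -> R) (M : R) : Sn n x ->
  (forall k, (K <= k)%N -> x k = 0) ->
  avg x K (comp_cost M g) = M - avg x K g.
Proof.
move=> Sx hK; rewrite /Kavg /comp_cost asboolT//.
have -> : \sum_(k < K) (up x k * (if `[< Sn n (sp x k) >] then M - g (sp x k) else 0)
   + dn x k * (if `[< Sn n (sm x k) >] then M - g (sm x k) else 0)) =
   M * (\sum_(k < K) (up x k + dn x k)) -
   \sum_(k < K) (up x k * g (sp x k) + dn x k * g (sm x k)).
  rewrite mulr_sumr -sumrB; apply: eq_bigr => k _.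
  have -> : up x k * (if `[< Sn n (sp x k) >] then M - g (sp x k) else 0) =
      up x k * (M - g (sp x k)).
    have [->|u0] := eqVneq (up x k) 0; first by rewrite !mul0r.
    by rewrite asboolT//; exact: shift_up_Sn u0.
  have -> : dn x k * (if `[< Sn n (sm x k) >] then M - g (sm x k) else 0) =
      dn x k * (M - g (sm x k)).
    have [->|u0] := eqVneq (dn x k) 0; first by rewrite !mul0r.
    by rewrite asboolT//; exact: shift_dn_Sn u0.
  ring.
rewrite (diagK_finite _ _ _ _ _ x K)//; ring.
Qed.

(** On the left is the expectation of [g] over the listed successors, with all remaining mass
    charged the maximal value [M]. Written through [M - g], it needs only lower bounds on [p]. *)
Lemma one_step x K (g : seqR R -> R) (M dl th : R) : Sn n x ->
  (forall k, (K <= k)%N -> x k = 0) -> 0 <= dl ->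
  (forall z, Sn n z -> 0 <= g z <= M) -> th = n%:R * (lam + 1) * dl ->
  M - \sum_(y <- succs x K) comp_cost M g y * p dl x y <=
    g x + th * (avg x K g - g x) + 2 * M * th ^+ 2.
Proof.
move=> Sx hK dl0 g01 thE.
have c0 z : 0 <= comp_cost M g z.
  rewrite /comp_cost; case: asboolP => // Sz; rewrite subr_ge0.
  by case/andP: (g01 z Sz).
have := ptrans_succs x K (comp_cost M g) dl Sx hK dl0 c0.
rewrite -thE Kavg_comp_cost// [comp_cost M g x]/comp_cost asboolT//.
have th0 : 0 <= th by rewrite thE !mulr_ge0// addr_ge0.
have E0 : 0 <= expR (- th) by exact: expR_ge0.
have E1 : 1 - th <= expR (- th) by exact: expR_ge1Dx.
have E2 : expR (- th) * (1 + th) <= 1.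
  rewrite expRN mulrC ler_pdivrMr ?expR_gt0// mul1r; exact: expR_ge1Dx.
have E3 : expR (- th) <= 1 by rewrite -expR0 ler_expR oppr_le0.
have /andP[gx0 gx1] := g01 x Sx.
have /andP[a0 a1] := Kavg_01 _ _ _ _ d n0 lam0 q0 q1 x K g M Sx hK g01.
set A := avg x K g in a0 a1 *; set E := expR (- th) in E0 E1 E2 E3 *.
set S := \sum_(_ <- _) _ => hS.
have t2 : 0 <= th ^+ 2 by rewrite exprn_ge0.
(* The first two Poisson weights add up to at least [1 - th ^+ 2], so two or more jumps cost at most
   [M * th ^+ 2]. *)
have h1 : E * (1 + th) >= 1 - th ^+ 2.
  apply: (@le_trans _ _ ((1 - th) * (1 + th))); first by rewrite expr2; lra.
  by rewrite ler_wpM2r// addr_ge0.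
have h2 : E * th * (A - g x) <= th * (A - g x) + th ^+ 2 * M.
  have e : 0 <= th - E * th <= th ^+ 2.
    by rewrite expr2; apply/andP; split; nra.
  have : `|(th - E * th) * (A - g x)| <= th ^+ 2 * M.
    case/andP: e => e0 e1.
    rewrite normrM (ger0_norm e0) ler_pM// ler_norml; lra.
  by rewrite ler_norml; lra.
have h3 : M * (1 - E * (1 + th)) <= M * th ^+ 2.
  by rewrite ler_wpM2l//; lra.
have h4 : E * (1 + th) * g x <= g x by rewrite ler_piMl.
have h5 : E * (M - g x + th * (M - A)) =
   M * (E * (1 + th)) - E * (1 + th) * g x - E * th * (A - g x) by ring.
by rewrite h5 in hS; lra.
Qed.

Local Notation w k := ((2^-1 : R) ^+ k).

(** With squares, the random part of a jump enters only through rate times squared size, that is [n]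
    times [n%:R^-1 ^+ 2]. Coordinate 0 equals 1 on U and is left out. *)
Definition Phi m x y : R := \sum_(k < m) w k * (x k.+1 - y k.+1) ^+ 2.

Lemma Phi_ge0 m x y : 0 <= Phi m x y.
Proof. by apply: sumr_ge0 => k _; rewrite mulr_ge0 ?sqr_ge0 ?exprn_ge0 ?invr_ge0. Qed.

Lemma sum_half m : \sum_(k < m) w k <= 2.
Proof.
have -> : \sum_(k < m) w k = 2 - 2 * w m.
  elim: m => [|m IH]; first by rewrite big_ord0 expr0; ring.
  by rewrite big_ord_recr /= IH exprS; field.
by rewrite gerBl mulr_ge0 ?exprn_ge0 ?invr_ge0.
Qed.

Lemma sqr_dist_le1 x y k : Uset x -> Uset y -> (x k - y k) ^+ 2 <= 1.
Proof.
move=> Ux Uy; rewrite -real_normK ?num_real//.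
by rewrite exprn_ile1//; exact: Uset_dist.
Qed.

Lemma Phi_le2 m x y : Uset x -> Uset y -> Phi m x y <= 2.
Proof.
move=> Ux Uy; apply: le_trans (sum_half m); apply: ler_sum => k _.
by rewrite ler_piMr ?exprn_ge0 ?invr_ge0//; exact: sqr_dist_le1.
Qed.

Lemma Phi_shift_le m x y : Uset x -> Uset y ->
  \sum_(k < m) w k * (x k - y k) ^+ 2 <= Phi m x y.
Proof.
move=> Ux Uy; case: m => [|m]; first by rewrite /Phi !big_ord0.
rewrite big_ord_recl /= /Phi big_ord_recr /=.
have [-> _] := Ux; have [-> _] := Uy; rewrite subrr expr0n mulr0 add0r.
rewrite -[leLHS]addr0 lerD//; last by rewrite mulr_ge0 ?sqr_ge0 ?exprn_ge0 ?invr_ge0.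
apply: ler_sum => k _; rewrite ler_wpM2r ?sqr_ge0// /bump /= add1n exprS.
by rewrite ler_piMl ?exprn_ge0 ?invr_ge0//; lra.
Qed.

(** Doubling the weights turns the left-hand side into [Phi] moved by one index; the missing first
    term has the right sign and the extra last term is at most [2 * w m]. *)
Lemma Phi_shift2_le m x y : Uset x -> Uset y ->
  \sum_(k < m) w k * (x k.+2 - y k.+2) ^+ 2 <= 2 * Phi m x y + 2 * w m.
Proof.
move=> Ux Uy.
have -> : \sum_(k < m) w k * (x k.+2 - y k.+2) ^+ 2 = 2 * Phi m x y -
    2 * (x 1%N - y 1%N) ^+ 2 + 2 * w m * (x m.+1 - y m.+1) ^+ 2.
  elim: m => [|m IH]; first by rewrite /Phi !big_ord0 expr0; ring.
  by rewrite /Phi !big_ord_recr /= -/(Phi m x y) IH [2^-1 ^+ m.+1]exprS; field.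
have h1 : 0 <= (x 1%N - y 1%N) ^+ 2 by exact: sqr_ge0.
have h2 : 2 * w m * (x m.+1 - y m.+1) ^+ 2 <= 2 * w m.
  by rewrite ler_piMr ?sqr_dist_le1// mulr_ge0 ?exprn_ge0 ?invr_ge0.
lra.
Qed.

End OneStep.
Arguments Phi {R} m x y.

(** * Drift of the weighted squared distance *)

Section Drift.
Variables (R : realType) (n : nat) (lam q : R) (d : nat).
Hypotheses (n0 : (0 < n)%N) (lam0 : 0 <= lam) (lam1 : lam <= 1).
Hypotheses (q0 : 0 < q) (q1 : q <= 1).
Implicit Types (x y z : seqR R) (k j : nat).

Local Notation up := (upK lam).
Local Notation dn := (dnK n lam q d).
Local Notation p := (ptrans n lam q d).
Local Notation sp x k := (Defs.shift x k n%:R^-1).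
Local Notation sm x k := (Defs.shift x k (- n%:R^-1)).
Local Notation avg := (Kavg R n lam q d).
Local Notation F := (lcq_rhs lam d).
Local Notation L := (lipF R d).
Local Notation w k := ((2^-1 : R) ^+ k).

Lemma Phi_shift m x y k s : Phi m (Defs.shift x k s) y =
  Phi m x y + (if (k < m)%N then w k * (2 * (x k.+1 - y k.+1) * s + s ^+ 2) else 0).
Proof.
apply/eqP; rewrite [eqbRHS]addrC -subr_eq /Phi -sumrB; apply/eqP.
case: ifPn => km; last first.
  rewrite big1// => i _; rewrite /Defs.shift eqSS.
  by rewrite ltn_eqF ?subrr// (leq_trans (ltn_ord i))// leqNgt.
rewrite (bigD1 (Ordinal km))//= big1 ?addr0.
  by rewrite /Defs.shift eqxx; ring.
move=> i ik; rewrite /Defs.shift eqSS.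
by case: eqP => [e|_]; [move: ik; rewrite -val_eqE /= e eqxx|rewrite subrr].
Qed.

Lemma Kavg_diff x K (g : seqR R -> R) : (forall k, (K <= k)%N -> x k = 0) ->
  avg x K g - g x =
  \sum_(k < K) (up x k * (g (sp x k) - g x) + dn x k * (g (sm x k) - g x)).
Proof.
move=> hK; rewrite /Kavg (diagK_finite _ _ _ _ _ x K)//.
rewrite [RHS](eq_bigr (fun k : 'I_K => (up x k * g (sp x k) + dn x k * g (sm x k)) -
   (up x k + dn x k) * g x)); last by move=> k _; ring.
by rewrite sumrB -mulr_suml; ring.
Qed.

Definition arrive x k : R := lam * (x k - x k.+1).
Definition depart x k : R :=
  alpha n q * ((1 - x k.+2) ^+ d - (1 - x k.+1) ^+ d).

(** The factor [n * (lam + 1)] of [th] cancels the normalization of the kernel. A jump [s = n%:R^-1]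
    or [s = - n%:R^-1] changes the square of a difference [D] by [2 * D * s + s ^+ 2], whence the
    drift term and the term divided by [n]. *)
Lemma Phi_generator m x y K dl th : (forall k, (K <= k)%N -> x k = 0) ->
  (m <= K)%N -> th = n%:R * (lam + 1) * dl ->
  th * (avg x K (Phi m ^~ y) - Phi m x y) =
  \sum_(k < m) w k * (dl * (2 * (arrive x k - depart x k) *
    (x k.+1 - y k.+1) + (arrive x k + depart x k) / n%:R)).
Proof.
move=> hK mK ->; rewrite Kavg_diff//; pose a := arrive x; pose b := depart x.
rewrite (big_ord_widen K (fun k => w k * (dl * (2 * (a k - b k) *
   (x k.+1 - y k.+1) + (a k + b k) / n%:R)))) // /a /b [RHS]big_mkcond /= mulr_sumr.
have nR : n%:R != 0 :> R by rewrite pnatr_eq0 -lt0n.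
have lR : lam + 1 != 0 by rewrite gt_eqF// ltr_wpDl.
apply: eq_bigr => k _; rewrite !Phi_shift; case: ifP => _; last by ring.
by rewrite /upK /dnK /arrive /depart; field; rewrite nR lR.
Qed.

(** Per coordinate, the errors in [dl ^+ 2] are [2 * L] from the Taylor remainder of the flow,
    [(1 + L) ^+ 2] from its squared displacement and [2 * (1 + L)] from drift times displacement;
    the outer 2 bounds the sum of the weights. *)
Definition driftC : R := 2 * (2 * L + (1 + L) ^+ 2 + 2 * (1 + L)).
Definition noise m : R :=
  4 / n%:R + 4 * (1 - q) ^+ n + 2 * d%:R * w m.

Lemma coord_drift x y y' dl k :
  Uset x -> Uset y -> Uset y' -> 0 <= dl -> dl <= 1 ->
  `|y' k.+1 - y k.+1 - dl * F y k.+1| <= L * dl ^+ 2 ->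
  (x k.+1 - y' k.+1) ^+ 2 + dl * (2 * (arrive x k - depart x k) *
    (x k.+1 - y' k.+1) + (arrive x k + depart x k) / n%:R)
  <= (x k.+1 - y k.+1) ^+ 2 +
     dl * ((3 + 3 * d%:R) * (x k.+1 - y k.+1) ^+ 2 + (x k - y k) ^+ 2
           + d%:R * (x k.+2 - y k.+2) ^+ 2)
     + dl * (2 * (1 - q) ^+ n + 2 / n%:R) + driftC / 2 * dl ^+ 2.
Proof.
move=> Ux Uy Uy' dl0 dl1 hy; set a := arrive x k; set b := depart x k; have l0 := lam0; have l1 := lam1.
have nR : 0 < n%:R :> R by rewrite ltr0n.
have L0 : 0 <= L by exact: lipF_ge0.
have d0 : 0 <= d%:R :> R by [].
have /andP[al0 al1] := alpha_01 _ n _ q0 q1.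
have nq0 : 0 <= (1 - q) ^+ n by rewrite exprn_ge0// subr_ge0.
have /andP[p0 _] := Uset_powD _ x k.+1 d Ux.
have p1 := Uset_powD_le1 _ x k.+1 d Ux.
set P := (1 - x k.+2) ^+ d - _ in p0 p1.
have a01 : 0 <= a <= 1.
  have := Uset_S _ x k Ux; have := Uset_le1 _ x k Ux.
  have := Uset_ge0 _ x k.+1 Ux => h0 h1 h2.
  by rewrite /a /arrive mulr_ge0 ?mulr_ile1//; lra.
have b01 : 0 <= b <= 1 by rewrite /b /depart mulr_ge0 ?mulr_ile1.
have [a0 a1] := andP a01; have [b0 b1] := andP b01.
(* Because [alpha n q] is [1 - (1 - q) ^+ n], the drift of the system is the right-hand side of the
   equation plus [beta]. *)
pose beta := (1 - q) ^+ n * P.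
have be0 : 0 <= beta by rewrite mulr_ge0.
have be1 : beta <= (1 - q) ^+ n by rewrite ler_piMr.
have ab : a - b = F x k.+1 + beta.
  by rewrite /a /b /arrive /depart /beta /lcq_rhs /alpha /P /=; ring.
set D := x k.+1 - y k.+1; set Dm := x k - y k; set Dp := x k.+2 - y k.+2.
have D1 : `|D| <= 1 by exact: Uset_dist.
set r := y' k.+1 - y k.+1 - dl * F y k.+1 in hy.
(* The displacement of the flow during [dl]. *)
pose s := dl * F y k.+1 + r.
have es : x k.+1 - y' k.+1 = D - s by rewrite /D /s /r; ring.
have dl2 : dl ^+ 2 <= dl by rewrite expr2 ler_piMr.
have dl20 : 0 <= dl ^+ 2 by rewrite exprn_ge0.
have Fy := lcq_rhs_le1 _ lam d lam0 lam1 y k Uy.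
have hs : `|s| <= (1 + L) * dl.
  apply: (le_trans (ler_normD _ _)); rewrite mulrDl mul1r lerD//.
    by rewrite normrM ger0_norm// ler_piMr.
  by apply: (le_trans hy); rewrite ler_wpM2l.
have hs2 : s ^+ 2 <= (1 + L) ^+ 2 * dl ^+ 2.
  rewrite -exprMn -(real_normK (num_real s)) lerXn2r// nnegrE.
  by rewrite mulr_ge0// addr_ge0.
have hDr : `|D * r| <= L * dl ^+ 2.
  by rewrite normrM -[leRHS]mul1r ler_pM.
have hab : `|a - b| <= 1 by rewrite ler_norml; lra.
have habs : `|(a - b) * s| <= (1 + L) * dl.
  by rewrite normrM -[leRHS]mul1r ler_pM.
have hbD : `|beta * D| <= (1 - q) ^+ n.
  by rewrite normrM (ger0_norm be0) -[leRHS]mulr1 ler_pM.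
have hF := lcq_rhs_lip R lam d lam0 x y k _ _ _ Ux Uy (lexx _) (lexx _) (lexx _).
(* Mixed products are split by [2 * a * b <= a ^+ 2 + b ^+ 2]; the coefficients [3 + 3 * d%:R], 1
   and [d%:R] arise here. *)
have hDF : 2 * (D * (F x k.+1 - F y k.+1)) <=
   (3 + 3 * d%:R) * D ^+ 2 + Dm ^+ 2 + d%:R * Dp ^+ 2.
  have h1 : D * (F x k.+1 - F y k.+1) <=
      `|D| * (lam * (`|Dm| + `|D|) + d%:R * (`|D| + `|Dp|)).
    by apply: (le_trans (ler_norm _)); rewrite normrM ler_wpM2l.
  rewrite -(real_normK (num_real D)) -(real_normK (num_real Dm)).
  rewrite -(real_normK (num_real Dp)).
  have q1' : 0 <= (`|D| - `|Dm|) ^+ 2 by exact: sqr_ge0.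
  have q2' : 0 <= (`|D| - `|Dp|) ^+ 2 by exact: sqr_ge0.
  have h2 : `|D| * (lam * (`|Dm| + `|D|)) <= `|D| * (`|Dm| + `|D|).
    by rewrite ler_wpM2l// ler_piMl// addr_ge0.
  have h3 : d%:R * (2 * `|D| * `|Dp|) <= d%:R * (`|D| ^+ 2 + `|Dp| ^+ 2).
    by rewrite ler_wpM2l//; nra.
  by move: h1 h2 h3 q1'; move: `|D| `|Dm| `|Dp| => X Y Z; rewrite !mulrDr; nra.
have hab2 : (a + b) / n%:R <= 2 / n%:R.
  by rewrite ler_wpM2r ?invr_ge0//; lra.
have e1 : (D - s) ^+ 2 + dl * (2 * (a - b) * (D - s) + (a + b) / n%:R) =
  D ^+ 2 + dl * (2 * (D * (F x k.+1 - F y k.+1))) - 2 * (D * r) + s ^+ 2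
   + dl * (2 * (beta * D)) - dl * (2 * ((a - b) * s)) + dl * ((a + b) / n%:R).
  rewrite ab /s; ring.
rewrite es e1.
have g1 := ler_wpM2l dl0 hDF.
have g2 : dl * (2 * (beta * D)) <= dl * (2 * (1 - q) ^+ n).
  by rewrite ler_wpM2l// ler_wpM2l// (le_trans (ler_norm _)).
have g3 : - (dl * (2 * ((a - b) * s))) <= dl * (2 * ((1 + L) * dl)).
  by rewrite -mulrN -mulrN ler_wpM2l// ler_wpM2l// (le_trans (ler_norm _))// normrN.
have g4 := ler_wpM2l dl0 hab2.
have g5 : dl * (2 * ((1 + L) * dl)) = 2 * (1 + L) * dl ^+ 2 by ring.
have g6 : driftC / 2 * dl ^+ 2 =
   2 * (L * dl ^+ 2) + (1 + L) ^+ 2 * dl ^+ 2 + 2 * (1 + L) * dl ^+ 2.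
  by rewrite /driftC; field.
move: hDr; rewrite ler_norml => /andP[hDr _].
rewrite g6 mulrDr; lra.
Qed.

(** In the weighted sum of [coord_drift] the coordinate itself contributes [3 + 3 * d%:R], its lower
    neighbour 1 and its upper neighbour [2 * d%:R]; together this is the rate [4 + 5 * d%:R]. *)
Lemma Phi_drift m x y y' dl K th :
  Sn n x -> Uset y -> Uset y' -> 0 <= dl -> dl <= 1 ->
  (forall k, `|y' k.+1 - y k.+1 - dl * F y k.+1| <= L * dl ^+ 2) ->
  (forall k, (K <= k)%N -> x k = 0) -> (m <= K)%N ->
  th = n%:R * (lam + 1) * dl ->
  Phi m x y' + th * (avg x K (Phi m ^~ y') - Phi m x y') <=
   (1 + (4 + 5 * d%:R) * dl) * Phi m x y + dl * noise m + driftC * dl ^+ 2.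
Proof.
move=> Sx Uy Uy' dl0 dl1 hy hK mK thE; have Ux := Sx.1.
rewrite (Phi_generator m x y' K dl th hK mK thE) -big_split /=.
have w0 k : 0 <= w k by rewrite exprn_ge0 ?invr_ge0.
pose C := dl * (2 * (1 - q) ^+ n + 2 / n%:R) + driftC / 2 * dl ^+ 2.
have L0 : 0 <= L by exact: lipF_ge0.
have C0 : 0 <= C.
  rewrite /C /driftC; apply: addr_ge0.
    rewrite mulr_ge0// addr_ge0 ?mulr_ge0 ?invr_ge0// exprn_ge0//.
    by rewrite subr_ge0.
  rewrite mulr_ge0 ?sqr_ge0// mulr_ge0 ?invr_ge0// mulr_ge0// !addr_ge0 ?sqr_ge0//.
    by rewrite mulr_ge0.
  by rewrite mulr_ge0// addr_ge0.
apply: (@le_trans _ _ (\sum_(k < m)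
  (w k * (x k.+1 - y k.+1) ^+ 2 + dl * ((3 + 3 * d%:R) * (w k * (x k.+1 - y k.+1) ^+ 2)
     + w k * (x k - y k) ^+ 2 + d%:R * (w k * (x k.+2 - y k.+2) ^+ 2)) + w k * C))).
  apply: ler_sum => k _; rewrite -mulrDr.
  have := coord_drift x y y' dl k Ux Uy Uy' dl0 dl1 (hy k) => h.
  apply: (le_trans (ler_wpM2l (w0 k) h)).
  by rewrite /C le_eqVlt; apply/orP; left; apply/eqP; ring.
rewrite !big_split /= -mulr_sumr !big_split /= -!mulr_sumr -mulr_suml.
rewrite -/(Phi m x y).
have h1 := Phi_shift_le _ m x y Ux Uy.
have h2 := Phi_shift2_le _ m x y Ux Uy.
have h3 : (\sum_(k < m) w k) * C <= 2 * C by rewrite ler_wpM2r// sum_half.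
have d0 : 0 <= d%:R :> R by [].
have h4 := ler_wpM2l d0 h2.
have h5 : dl * ((3 + 3 * d%:R) * Phi m x y + \sum_(i < m) w i * (x i - y i) ^+ 2 +
   d%:R * (\sum_(i < m) w i * (x i.+2 - y i.+2) ^+ 2)) <=
   dl * ((3 + 3 * d%:R) * Phi m x y + Phi m x y + d%:R * (2 * Phi m x y + 2 * w m)).
  by rewrite ler_wpM2l// !lerD.
apply: (le_trans (lerD (lerD (lexx _) h5) h3)).
rewrite /C /noise le_eqVlt; apply/orP; left; apply/eqP; field.
by rewrite pnatr_eq0 -lt0n.
Qed.

Lemma ptrans_Phi_drift m x y y' dl :
  Sn n x -> Uset y -> Uset y' -> 0 <= dl -> dl <= 1 ->
  (forall k, `|y' k.+1 - y k.+1 - dl * F y k.+1| <= L * dl ^+ 2) ->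
  exists2 s : seq (seqR R), uniq s &
   2 - \sum_(z <- s) comp_cost R n 2 (Phi m ^~ y') z * p dl x z <=
   (1 + (4 + 5 * d%:R) * dl) * Phi m x y + dl * noise m
     + (driftC + 4 * (n%:R * (lam + 1)) ^+ 2) * dl ^+ 2.
Proof.
move=> Sx Uy Uy' dl0 dl1 hy; have [_ [_ [K0 hK0]]] := Sx.
pose K := maxn K0 m.
have hK k : (K <= k)%N -> x k = 0 by rewrite geq_max => /andP[/hK0].
have mK : (m <= K)%N by rewrite leq_maxr.
exists (succs R n x K); first exact: undup_uniq.
have g01 z : Sn n z -> 0 <= Phi m z y' <= 2.
  by move=> [Uz _]; rewrite Phi_ge0 Phi_le2.
have h1 := one_step R n lam q d n0 lam0 q0 q1 x K (Phi m ^~ y') 2 dl _ Sx hK dl0 g01 erefl.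
have h2 := Phi_drift m x y y' dl K _ Sx Uy Uy' dl0 dl1 hy hK mK erefl.
apply: (le_trans h1); apply: (le_trans (lerD h2 (lexx _))).
by rewrite le_eqVlt; apply/orP; left; apply/eqP; ring.
Qed.

End Drift.

(** * A maximal inequality on time grids *)

Section RealProbability.
Variables (R : realType) (dm : measure_display) (Om : measurableType dm).
Variable P : probability Om R.

Definition pr (A : set Om) : R := fine (P A).

Lemma prE A : measurable A -> P A = (pr A)%:E.
Proof. by move=> mA; rewrite /pr fineK// fin_num_measure. Qed.

Lemma pr_ge0 A : 0 <= pr A.
Proof. by rewrite /pr fine_ge0. Qed.

Lemma pr_le A B : measurable A -> measurable B -> A `<=` B -> pr A <= pr B.
Proof.
move=> mA mB AB; rewrite -lee_fin -!prE//.
by apply: le_measure => //; rewrite inE.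
Qed.

Lemma prT : pr setT = 1.
Proof. by rewrite /pr probability_setT. Qed.

Lemma pr0 : pr set0 = 0.
Proof. by rewrite /pr measure0. Qed.

Lemma pr_split A B : measurable A -> measurable B ->
  pr A = pr (A `&` B) + pr (A `\` B).
Proof.
move=> mA mB; have mI := measurableI _ _ mA mB; have mD := measurableD mA mB.
apply/EFin_inj; rewrite EFinD -!prE// addeC.
by apply: measureDI.
Qed.

Lemma pr_setC A : measurable A -> pr (~` A) = 1 - pr A.
Proof.
move=> mA; have := pr_split setT A measurableT mA.
by rewrite prT setTI setTD => ->; rewrite addrAC subrr add0r.
Qed.

Lemma pr_fibers (T : eqType) (Y : Om -> T) (s : seq T) A :
  measurable A -> (forall z, measurable [set w | Y w = z]) -> uniq s ->
  pr A = \sum_(z <- s) pr (A `&` [set w | Y w = z]) + pr (A `&` [set w | Y w \notin s]).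
Proof.
move=> mA mY; have mN (s' : seq T) : measurable [set w | Y w \notin s'].
  elim: s' => [|z s' IH].
    by rewrite (_ : [set w | _] = setT)//; apply/seteqP; split.
  rewrite (_ : [set w | _] = ~` [set w | Y w = z] `&` [set w | Y w \notin s']).
    by apply: measurableI => //; exact: measurableC.
  apply/seteqP; split=> w /=; rewrite inE negb_or.
    by move=> /andP[/eqP].
  by move=> [/eqP -> ->].
elim: s => [_|z s IH /= /andP[zs us]].
  rewrite big_nil add0r (_ : [set w | _] = setT) ?setIT//.
  by apply/seteqP; split.
rewrite big_cons [LHS]IH// (pr_split (A `&` [set w | Y w \notin s]) [set w | Y w = z])//;
  last exact: measurableI.
rewrite addrCA -[RHS]addrA; congr (pr _ + (_ + pr _)).
  apply/seteqP; split=> [w /= [[Aw _] Yw]//|w /= [Aw Yw]]; split=> //; split=> //.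
  by rewrite Yw.
apply/seteqP; split=> w /=; rewrite inE negb_or.
  by move=> [[Aw ->] /eqP ->].
by move=> [Aw /andP[/eqP ? ?]].
Qed.

End RealProbability.
Arguments pr {R dm Om} P A.

(** * The process on a time grid *)

Section Skeleton.
Variables (R : realType) (n : nat) (lam q : R) (d : nat).
Variables (dm : measure_display) (Om : measurableType dm) (P : probability Om R).
Variable X : Om -> pathR R.
Hypotheses (n0 : (0 < n)%N) (lam0 : 0 <= lam) (lam1 : lam <= 1).
Hypotheses (q0 : 0 < q) (q1 : q <= 1).
Hypothesis Xproc : is_LCQ_process n lam q d P X.

Local Notation F := (lcq_rhs lam d).
Local Notation L := (lipF R d).
Local Notation p := (ptrans n lam q d).
Local Notation pr := (pr P).
Local Notation flow := (flow R lam d).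

Definition decode_state (s : seq nat) : seqR R := fun k => (nth 0%N s k)%:R / n%:R.

Lemma Sn_decode x : Sn n x -> exists s, x = decode_state s.
Proof.
move=> [Ux [xn [K hK]]]; have [m mE] := choice xn.
exists (mkseq m K); apply/funext => k; rewrite /decode_state.
have nR : n%:R != 0 :> R by rewrite pnatr_eq0 -lt0n.
have [kK|Kk] := ltnP k K; first by rewrite nth_mkseq// -mE mulrC mulKf.
by rewrite nth_default ?size_mkseq// mul0r hK.
Qed.

Lemma proc_Sn w t : 0 <= t -> Sn n (X w t).
Proof. by case: Xproc => _ [+ _]; apply. Qed.

Lemma proc_Uset w t : 0 <= t -> Uset (X w t).
Proof. by move=> /(proc_Sn w)[]. Qed.

Lemma measurable_state t x : measurable [set w | X w t = x].
Proof. by case: Xproc => _ [_ [+ _]]; apply. Qed.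

(** The reachable states are countable by [Sn_decode], so an arbitrary relation, even one that
    involves [flow], gives a countable union of measurable events. *)
Lemma measurable_state2 t t' (A : seqR R -> seqR R -> Prop) : 0 <= t -> 0 <= t' ->
  measurable [set w | A (X w t) (X w t')].
Proof.
move=> t0 t'0.
rewrite (_ : [set w | _] = \bigcup_(ss : seq nat * seq nat)
   (if `[< A (decode_state ss.1) (decode_state ss.2) >] then
    [set w | X w t = decode_state ss.1] `&` [set w | X w t' = decode_state ss.2]
    else set0)).
  apply: countable_bigcupT_measurable; first exact: countableP.
  by move=> ss; case: asboolP => _ //; apply: measurableI; exact: measurable_state.
apply/seteqP; split=> w /=.
  have [s es] := Sn_decode _ (proc_Sn w t t0).
  have [s' es'] := Sn_decode _ (proc_Sn w t' t'0).
  move=> Aw; exists (s, s') => //=; rewrite -es -es' asboolT//.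
by move=> [ss _]; case: asboolP => //= Ass [-> ->].
Qed.

Definition hist (dl : R) i (xs : nat -> seqR R) : set Om :=
  [set w | forall j, (j <= i)%N -> X w (j%:R * dl) = xs j].

Lemma measurable_hist dl i xs : measurable (hist dl i xs).
Proof.
rewrite (_ : hist dl i xs = \bigcap_(j in [set j | (j <= i)%N])
    [set w | X w (j%:R * dl) = xs j]).
  apply: bigcap_measurable; first by exists 0%N.
  by move=> j _; exact: measurable_state.
by apply/seteqP; split=> w /= h j; exact: h.
Qed.

Lemma eq_hist dl i xs xs' : (forall j, (j <= i)%N -> xs j = xs' j) ->
  hist dl i xs = hist dl i xs'.
Proof.
by move=> h; apply/seteqP; split=> w /= hw j ji; rewrite hw// h.
Qed.

Lemma pr_hist dl i xs : 0 <= dl ->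
  pr (hist dl i xs) = pr (hist dl 0 xs) * \prod_(j < i) p dl (xs j) (xs j.+1).
Proof.
move=> dl0; have [_ [_ [_ fdd]]] := Xproc.
have h0 : hist dl 0 xs = [set w | X w 0 = xs 0%N].
  apply/seteqP; split=> w /= h; first by have := h 0%N (leqnn _); rewrite mul0r.
  by move=> j; rewrite leqn0 => /eqP ->; rewrite mul0r.
have := fdd i (fun j => j%:R * dl) xs.
rewrite mul0r => /(_ (lexx _)) h.
have mono j : j%:R * dl <= j.+1%:R * dl by rewrite ler_wpM2r// ler_nat.
move: (h mono); rewrite -h0 -/(hist dl i xs).
rewrite (prE _ _ _ P (hist dl i xs)); last exact: measurable_hist.
rewrite (prE _ _ _ P (hist dl 0 xs)); last exact: measurable_hist.
move=> [->]; congr (_ * _); apply: eq_bigr => j _.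
by rewrite -mulrBl -natrB// subSnn mul1r.
Qed.

Definition ext_hist i (xs : nat -> seqR R) z : nat -> seqR R :=
  fun j => if (j <= i)%N then xs j else z.

Lemma hist_ext dl i xs z : hist dl i.+1 (ext_hist i xs z) =
  hist dl i xs `&` [set w | X w (i.+1%:R * dl) = z].
Proof.
rewrite /ext_hist; apply/seteqP; split=> w /=.
  move=> h; split; last by rewrite h// ltnn.
  by move=> j ji; rewrite h ?ji// leqW.
move=> [h1 h2] j; rewrite leq_eqVlt ltnS => /orP[/eqP ->|ji].
  by rewrite ltnn.
by rewrite ji h1.
Qed.

(** The Markov property on the grid: the product formula for the longer history has one more
    factor. *)
Lemma pr_hist_ext dl i xs z : 0 <= dl ->
  pr (hist dl i xs `&` [set w | X w (i.+1%:R * dl) = z]) =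
  pr (hist dl i xs) * p dl (xs i) z.
Proof.
move=> dl0; rewrite -hist_ext pr_hist// (pr_hist dl i)//.
have -> : hist dl 0 (ext_hist i xs z) = hist dl 0 xs.
  by apply: eq_hist => j; rewrite leqn0 => /eqP ->.
rewrite big_ord_recr /= mulrA /ext_hist ltnn leqnn; congr (_ * _ * _).
by apply: eq_bigr => j _; rewrite ltnW// ltn_ord.
Qed.

Definition bad dl m a i r : set Om :=
  [set w | exists2 j, (i <= j <= i + r)%N &
     a <= Phi m (X w (j%:R * dl)) (flow (X w 0) (j%:R * dl))].

Lemma measurable_bad dl m a i r : 0 <= dl -> measurable (bad dl m a i r).
Proof.
move=> dl0; rewrite (_ : bad _ _ _ _ _ = \bigcup_(j in [set j | (i <= j <= i + r)%N])
   [set w | a <= Phi m (X w (j%:R * dl)) (flow (X w 0) (j%:R * dl))]).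
  apply: bigcup_measurable => j _.
  apply: (measurable_state2 _ _ (fun x y => a <= Phi m x (flow y (j%:R * dl)))) => //.
  by rewrite mulr_ge0.
by apply/seteqP; split=> w /=; [move=> [j jr h]; exists j|move=> [j jr h]; exists j].
Qed.

(** With [kappa], the one-step bound: the expectation of [Phi] after a step is at most [growth dl]
    times its value plus [kappa dl m]. *)
Definition growth dl : R := 1 + (4 + 5 * d%:R) * dl.
Definition kappa dl m : R := dl * noise R n q d m
     + (driftC R d + 4 * (n%:R * (lam + 1)) ^+ 2) * dl ^+ 2.

Lemma kappa_ge0 dl m : 0 <= dl -> 0 <= kappa dl m.
Proof.
move=> dl0; have L0 : 0 <= L by exact: lipF_ge0.
rewrite /kappa /noise /driftC; apply: addr_ge0; apply: mulr_ge0 => //.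
- have h1 : 0 <= (1 - q) ^+ n by rewrite exprn_ge0// subr_ge0.
  have h2 : 0 <= (2^-1 : R) ^+ m by rewrite exprn_ge0// invr_ge0.
  by rewrite !addr_ge0// !mulr_ge0// invr_ge0.
- apply: addr_ge0; last by rewrite mulr_ge0// sqr_ge0.
  by rewrite mulr_ge0// !addr_ge0 ?sqr_ge0// mulr_ge0// addr_ge0.
- exact: sqr_ge0.
Qed.

Lemma growth_ge1 dl : 0 <= dl -> 1 <= growth dl.
Proof. by move=> dl0; rewrite /growth lerDl mulr_ge0// addr_ge0// mulr_ge0. Qed.

(** When the threshold is already reached, the factor on the right is at least 1. *)
Lemma pr_hist_bad_ge dl m a r i xs : 0 <= dl -> 0 < a ->
  a <= Phi m (xs i) (flow (xs 0%N) (i%:R * dl)) ->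
  pr (hist dl i xs `&` bad dl m a i r) <=
  pr (hist dl i xs) * (growth dl ^+ r *
     (Phi m (xs i) (flow (xs 0%N) (i%:R * dl)) + r%:R * kappa dl m) / a).
Proof.
move=> dl0 a0 hi; have mH := measurable_hist dl i xs.
have mB := measurable_bad dl m a i r dl0; have k0 := kappa_ge0 dl m dl0.
have gr0 : 1 <= growth dl ^+ r by rewrite exprn_ege1// growth_ge1.
apply: (@le_trans _ _ (pr (hist dl i xs))).
  by apply: pr_le => //; exact: measurableI.
rewrite ler_peMr ?pr_ge0// ler_pdivlMr// mul1r (le_trans hi)//.
set f := Phi _ _ _; have f0 : 0 <= f by exact: Phi_ge0.
have rk : 0 <= r%:R * kappa dl m by exact: mulr_ge0.
apply: (@le_trans _ _ (f + r%:R * kappa dl m)); first by rewrite lerDl.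
by rewrite ler_peMl// addr_ge0.
Qed.

Lemma hist_Phi dl m i xs w : hist dl i xs w ->
  Phi m (X w (i%:R * dl)) (flow (X w 0) (i%:R * dl)) =
  Phi m (xs i) (flow (xs 0%N) (i%:R * dl)).
Proof.
move=> hw; rewrite -(hw i (leqnn _)).
by have := hw 0%N (leq0n _); rewrite mul0r => ->.
Qed.

Lemma hist_bad0 dl m a i xs : Phi m (xs i) (flow (xs 0%N) (i%:R * dl)) < a ->
  hist dl i xs `&` bad dl m a i 0 = set0.
Proof.
move=> lo; apply/seteqP; split=> // w [hw [j]].
by rewrite addn0 -eqn_leq => /eqP <-; rewrite (hist_Phi dl m i xs)// leNgt lo.
Qed.

Lemma hist_badS dl m a i xs r : Phi m (xs i) (flow (xs 0%N) (i%:R * dl)) < a ->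
  hist dl i xs `&` bad dl m a i r.+1 = hist dl i xs `&` bad dl m a i.+1 r.
Proof.
move=> lo; apply/seteqP; split=> w [hw [j]].
  rewrite leq_eqVlt => /andP[/orP[/eqP <- _|ij jr]].
    by rewrite (hist_Phi dl m i xs)// leNgt lo.
  by move=> h; split=> //; exists j => //; rewrite ij addSnnS.
by move=> /andP[ij jr] h; split=> //; exists j => //; rewrite ltnW//= -addSnnS.
Qed.

(* Backward induction on the number of remaining steps; only finitely many
   successors are inspected, all others are charged the maximal value 2. *)
Lemma pr_hist_bad dl m a r i xs : 0 <= dl -> dl <= 1 -> 0 < a -> a <= 2 ->
  pr (hist dl i xs `&` bad dl m a i r) <=
  pr (hist dl i xs) * (growth dl ^+ r *
     (Phi m (xs i) (flow (xs 0%N) (i%:R * dl)) + r%:R * kappa dl m) / a).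
Proof.
move=> dl0 dl1 a0 a2; elim: r i xs => [|r IH] i xs.
  have [lo|hi] := ltP (Phi m (xs i) (flow (xs 0%N) (i%:R * dl))) a; last first.
    exact: pr_hist_bad_ge.
  rewrite hist_bad0// pr0 mulr_ge0 ?pr_ge0// divr_ge0 ?(ltW a0)//.
  by rewrite expr0 mul1r mul0r addr0 Phi_ge0.
have [lo|hi] := ltP (Phi m (xs i) (flow (xs 0%N) (i%:R * dl))) a; last first.
  exact: pr_hist_bad_ge.
rewrite hist_badS//.
(* An empty history has probability 0; otherwise a path [w0] in it shows that [xs i] and [xs 0%N]
   are reachable states. *)
have [->|/set0P[w0 hw0]] := eqVneq (hist dl i xs) set0.
  by rewrite set0I pr0 mul0r.
have mH := measurable_hist dl i xs.
have mB := measurable_bad dl m a i.+1 r dl0.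
have g1 := growth_ge1 dl dl0; have k0 := kappa_ge0 dl m dl0.
have id0 : 0 <= i%:R * dl by rewrite mulr_ge0.
have Sxi : Sn n (xs i) by rewrite -hw0//; exact: proc_Sn.
have Sx0 : Sn n (xs 0%N) by rewrite -hw0// mul0r; exact: proc_Sn.
have [fl fl0] := flowP R lam d lam0 lam1 (xs 0%N) Sx0.1.
pose y := flow (xs 0%N) (i%:R * dl); pose y' := flow (xs 0%N) (i.+1%:R * dl).
have ei : i.+1%:R * dl = i%:R * dl + dl by rewrite -natr1 mulrDl mul1r.
have id1 : 0 <= i.+1%:R * dl by rewrite mulr_ge0.
have Uy : Uset y by exact: flow_Uset Sx0.1 _.
have Uy' : Uset y' by exact: flow_Uset Sx0.1 _.
have hy k : `|y' k.+1 - y k.+1 - dl * F y k.+1| <= L * dl ^+ 2.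
  by rewrite /y' ei; apply: fl.2.
have [s us hs] := ptrans_Phi_drift R n lam q d n0 lam0 lam1 q0 q1 m (xs i) y y' dl
  Sxi Uy Uy' dl0 dl1 hy.
set H := hist dl i xs in mH hw0 *.
set B := bad dl m a i.+1 r.
pose Y w := X w (i.+1%:R * dl).
have mY z : measurable [set w | Y w = z] by exact: measurable_state.
have mN : measurable [set w | Y w \notin s].
  exact: (measurable_state2 (i.+1%:R * dl) 0 (fun x _ => x \notin s)).
have mHB : measurable (H `&` B) by exact: measurableI.
rewrite (pr_fibers _ _ _ P _ Y s (H `&` B) mHB mY us).
have hN : pr (H `&` B `&` [set w | Y w \notin s]) <=
   pr H - \sum_(z <- s) pr H * p dl (xs i) z.
  have := pr_fibers _ _ _ P _ Y s H mH mY us.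
  under eq_bigr do rewrite pr_hist_ext//.
  move=> /eqP; rewrite addrC -subr_eq => /eqP ->.
  apply: pr_le; [exact: measurableI|exact: measurableI|].
  by move=> w [[]].
have hz z : pr (H `&` B `&` [set w | Y w = z]) <=
    pr H * p dl (xs i) z * (growth dl ^+ r * (Phi m z y' + r%:R * kappa dl m) / a).
  rewrite -pr_hist_ext// -hist_ext setIAC -hist_ext.
  apply: (le_trans (IH i.+1 (ext_hist i xs z))).
  by rewrite /ext_hist ltnn leq0n.
have hp0 z : ~ Sn n z -> pr H * p dl (xs i) z = 0.
  move=> nS; rewrite -pr_hist_ext//.
  rewrite (_ : _ `&` _ = set0) ?pr0//; apply/seteqP; split=> // w /= [_ e].
  by apply: nS; rewrite -e; exact: proc_Sn.
set G := growth dl ^+ r; set kp := kappa dl m.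
have G1 : 1 <= G by rewrite exprn_ege1.
(* Since [a <= 2], the added factor is at least 1: unlisted successors are treated as if [Phi] were
   2 there. *)
have step1 : pr (H `&` B `&` [set w | Y w \notin s]) <=
    (pr H - \sum_(z <- s) pr H * p dl (xs i) z) * (G * (2 + r%:R * kp) / a).
  have q0' : 0 <= pr (H `&` B `&` [set w | Y w \notin s]) by exact: pr_ge0.
  apply: (le_trans hN); rewrite ler_peMr ?(le_trans q0' hN)//.
  rewrite ler_pdivlMr// mul1r (le_trans a2)//.
  rewrite (le_trans _ (ler_peMl _ G1))// ?addr_ge0 ?mulr_ge0// lerDl mulr_ge0//.
(* On [Sn n] one has [Phi = 2 - comp_cost], and off [Sn n] the weight vanishes by [hp0]. In this
   form the charges of listed and unlisted successors combine into the quantity bounded by [hs]. *)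
have step2 : \sum_(z <- s) pr (H `&` B `&` [set w | Y w = z]) <=
    \sum_(z <- s) (pr H * p dl (xs i) z * (G * (2 + r%:R * kp) / a)
      - pr H * (G / a) * (comp_cost R n 2 (Phi m ^~ y') z * p dl (xs i) z)).
  apply: ler_sum => z _; apply: (le_trans (hz z)).
  rewrite /comp_cost; case: asboolP => [_|/hp0 ->]; last by rewrite !(mul0r, mulr0) subr0.
  by rewrite le_eqVlt; apply/orP; left; apply/eqP; rewrite -/G -/kp; ring.
apply: (le_trans (lerD step2 step1)).
rewrite sumrB -mulr_suml -mulr_sumr.
rewrite (_ : _ + _ = pr H * (G / a) *
   ((2 - \sum_(z <- s) comp_cost R n 2 (Phi m ^~ y') z * p dl (xs i) z) + r%:R * kp)).
  rewrite -!mulrA; apply: ler_wpM2l; first exact: pr_ge0.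
  rewrite exprSr -!mulrA [growth dl * _]mulrCA -/G; apply: ler_wpM2l; first by lra.
  rewrite mulrC [leRHS]mulrA; apply: ler_wpM2r; first by rewrite invr_ge0 ltW.
  apply: (le_trans (lerD hs (lexx _))).
  rewrite -/(growth dl) -/y -[X in X + _]addrA -/(kappa dl m) -/kp.
  have rk : 0 <= kp + r%:R * kp by rewrite addr_ge0// mulr_ge0.
  have := ler_peMl rk g1; rewrite -natr1.
  lra.
by rewrite -mulr_sumr; ring.
Qed.

End Skeleton.

Lemma half_small {R : realType} (e : R) : 0 < e -> exists l, (2^-1 : R) ^+ l < e.
Proof.
move=> e0; have h : (2^-1 : R) ^+ l @[l --> \oo] --> 0.
  by apply: cvg_expr; rewrite ger0_norm ?invr_ge0//; lra.
have /cvgrPdist_lt /(_ e e0) [l _ hl] := h.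
by exists l; have := hl l (leqnn l); rewrite /= sub0r normrN ger0_norm// exprn_ge0// invr_ge0.
Qed.

Lemma half_le {R : realType} i j : (i <= j)%N -> (2^-1 : R) ^+ j <= 2^-1 ^+ i.
Proof. by move=> ij; apply: ler_wiXn2l => //; rewrite ?invr_ge0//; lra. Qed.

Section ContinuityFromBelow.
Variables (R : realType) (dm : measure_display) (Om : measurableType dm).
Variable P : probability Om R.

Lemma pr_bigcup_le (G : nat -> set Om) (z : R) : (forall i, measurable (G i)) ->
  (forall i j, (i <= j)%N -> G i `<=` G j) -> (forall i, pr P (G i) <= z) ->
  pr P (\bigcup_i G i) <= z.
Proof.
move=> mG ndG hz.
have mU : measurable (\bigcup_i G i) by exact: bigcup_measurable.
have nd : nondecreasing_seq G by move=> i j ij; apply/subsetPset; exact: ndG.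
have := @nondecreasing_cvg_mu _ _ _ P _ mG mU nd.
rewrite -lee_fin -prE// => h; rewrite -(cvg_lim _ h)//.
apply: lime_le; first by apply/cvg_ex; eexists; exact: h.
by apply: nearW => i; rewrite /= prE// lee_fin.
Qed.

End ContinuityFromBelow.

(** * Closeness of path and flow on a bounded time interval *)

Section Concentration.
Variables (R : realType) (n : nat) (lam q : R) (d : nat).
Variables (dm : measure_display) (Om : measurableType dm) (P : probability Om R).
Variable X : Om -> pathR R.
Hypotheses (n0 : (0 < n)%N) (lam0 : 0 <= lam) (lam1 : lam <= 1).
Hypotheses (q0 : 0 < q) (q1 : q <= 1).
Hypothesis Xproc : is_LCQ_process n lam q d P X.

Local Notation pr := (pr P).
Local Notation flow := (flow R lam d).
Local Notation bad := (bad R lam d dm Om X).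
Local Notation kappa := (kappa R n lam q d).
Local Notation growth := (growth R d).
Local Notation noise := (noise R n q d).
Local Notation h l := ((2^-1 : R) ^+ l).
Local Notation mstate := (measurable_state R n lam q d dm Om P X Xproc).
Local Notation mstate2 := (measurable_state2 R n lam q d dm Om P X n0 Xproc).
Local Notation mbad := (measurable_bad R n lam q d dm Om P X n0 Xproc).

(** This averages [pr_hist_bad] at time 0 over the initial state; there [Phi] is 0, because the flow
    starts at the state of the path. *)
Lemma pr_bad dl m a N : 0 <= dl -> dl <= 1 -> 0 < a -> a <= 2 ->
  pr (bad dl m a 0 N) <= growth dl ^+ N * (N%:R * kappa dl m) / a.
Proof.
move=> dl0 dl1 a0 a2; set z := _ / a.
have mB := mbad dl m a 0%N N dl0.
have z0 : 0 <= z.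
  rewrite /z divr_ge0 ?(ltW a0)// mulr_ge0 ?exprn_ge0 ?mulr_ge0//.
    by rewrite (le_trans ler01)// growth_ge1.
  exact: kappa_ge0.
pose dec i : seqR R := decode_state R n (odflt [::] (unpickle i)).
pose s M := undup [seq dec i | i <- iota 0 M].
have mX x : measurable [set w | X w 0 = x] by exact: mstate.
have hx x : pr (bad dl m a 0 N `&` [set w | X w 0 = x]) <=
    pr [set w | X w 0 = x] * z.
  have [Sx|nSx] := pselect (Sn n x); last first.
    rewrite (_ : [set w | _] = set0) ?setI0 ?pr0 ?mul0r//.
    apply/seteqP; split=> // w /= e; apply: nSx; rewrite -e.
    exact: (proc_Sn R n lam q d dm Om P X Xproc).
  have := pr_hist_bad R n lam q d dm Om P X n0 lam0 lam1 q0 q1 Xproc dl m a N 0%N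
    (fun=> x) dl0 dl1 a0 a2.
  have -> : hist R dm Om X dl 0 (fun=> x) = [set w | X w 0 = x].
    apply/seteqP; split=> w /=; first by move=> /(_ 0%N (leqnn _)); rewrite mul0r.
    by move=> e j; rewrite leqn0 => /eqP ->; rewrite mul0r.
  rewrite mul0r (flowP R lam d lam0 lam1 x Sx.1).2 setIC.
  rewrite (_ : Phi m x x = 0) ?add0r//.
  by rewrite /Phi big1// => k _; rewrite subrr expr0n mulr0.
have mS M : measurable [set w | X w 0 \in s M].
  by apply: (mstate2 0 0 (fun x _ => x \in s M)).
(* Written as an upper bound on the probability that the initial state is in a finite list, so that
   continuity from below applies: the lists exhaust the reachable states and this probability rises
   to 1. *)
have key M : pr [set w | X w 0 \in s M] <= 1 + z - pr (bad dl m a 0 N).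
  have us : uniq (s M) by exact: undup_uniq.
  have e1 := pr_fibers _ _ _ P _ (fun w => X w 0) (s M) _ mB mX us.
  have e2 := pr_fibers _ _ _ P _ (fun w => X w 0) (s M) _ measurableT mX us.
  rewrite prT in e2.
  have h1 : \sum_(x <- s M) pr (bad dl m a 0 N `&` [set w | X w 0 = x]) <=
     (\sum_(x <- s M) pr (setT `&` [set w | X w 0 = x])) * z.
    by rewrite mulr_suml; apply: ler_sum => x _; rewrite setTI.
  have h2 : (\sum_(x <- s M) pr (setT `&` [set w | X w 0 = x])) * z <= z.
    by rewrite ler_piMl// e2 lerDl pr_ge0.
  have mN : measurable [set w | X w 0 \notin s M].
    by apply: (mstate2 0 0 (fun x _ => x \notin s M)).
  have h3 : pr (bad dl m a 0 N `&` [set w | X w 0 \notin s M]) <=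
     pr [set w | X w 0 \notin s M].
    by apply: pr_le => //; exact: measurableI.
  have h4 : pr [set w | X w 0 \notin s M] = 1 - pr [set w | X w 0 \in s M].
    rewrite -pr_setC//; congr pr; by apply/seteqP; split=> w /= /negP.
  by lra.
suff : pr (\bigcup_M [set w | X w 0 \in s M]) <= 1 + z - pr (bad dl m a 0 N).
  rewrite (_ : \bigcup_M _ = setT) ?prT; first by lra.
  apply/seteqP; split=> // w _.
  have [t et] := Sn_decode R n n0 _ (proc_Sn R n lam q d dm Om P X Xproc w 0 (lexx _)).
  exists (pickle t).+1 => //=; rewrite mem_undup; apply/mapP.
  exists (pickle t); first by rewrite mem_iota /=.
  by rewrite /dec pickleK.
apply: pr_bigcup_le => // i j ij w /=; rewrite !mem_undup => /mapP[k].
rewrite mem_iota add0n /= => ki e; apply/mapP; exists k => //.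
by rewrite mem_iota add0n /= (leq_trans ki).
Qed.

Definition dyadic_bad m a T l : set Om := bad (h l) m a 0 (T * 2 ^ l).

Lemma half_exp2 l : h l = (2 ^ l)%:R^-1.
Proof. by rewrite exprVn natrX. Qed.

Lemma dyadic_bad_mono m a T i j : (i <= j)%N ->
  dyadic_bad m a T i `<=` dyadic_bad m a T j.
Proof.
move=> ij w [k /=]; rewrite add0n => kT hk.
exists (k * 2 ^ (j - i))%N; rewrite /= ?add0n.
  by rewrite -[in X in (_ <= T * X)%N](subnK ij) addnC expnD mulnA leq_mul2r kT orbT.
have -> : (k * 2 ^ (j - i))%:R * h j = k%:R * h i :> R.
  rewrite natrM -mulrA; congr (_ * _).
  rewrite -[in h j](subnK ij) exprD mulrA half_exp2 divff ?mul1r//.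
exact: hk.
Qed.

(** By monotonicity, level [l] may be estimated at any finer level [j], where the second-order error
    carries a factor [h j] and disappears in the limit. *)
Lemma pr_dyadic_bad m a T l : 0 < a -> a <= 2 ->
  pr (dyadic_bad m a T l) <= expR ((4 + 5 * d%:R) * T%:R) * T%:R * noise m / a.
Proof.
move=> a0 a2; set E := expR _.
have h0 i : 0 <= h i by rewrite exprn_ge0// invr_ge0.
have h1 i : h i <= 1 by rewrite exprn_ile1 ?invr_ge0//; lra.
pose C := driftC R d + 4 * (n%:R * (lam + 1)) ^+ 2.
have L0 : 0 <= lipF R d by exact: lipF_ge0.
have C0 : 0 <= C.
  apply: addr_ge0; last by rewrite mulr_ge0// sqr_ge0.
  by rewrite mulr_ge0// !addr_ge0 ?sqr_ge0// mulr_ge0// addr_ge0.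
have E0 : 0 <= E by exact: expR_ge0.
have bnd i : pr (dyadic_bad m a T i) <= E * T%:R * noise m / a + h i * (E * T%:R * C / a).
  apply: (le_trans (pr_bad _ _ _ _ (h0 i) (h1 i) a0 a2)).
  have Nh : (T * 2 ^ i)%:R * h i = T%:R.
    by rewrite natrM half_exp2 mulfK// ?pnatr_eq0 ?expn_eq0.
  have -> : (T * 2 ^ i)%:R * kappa (h i) m = T%:R * (noise m + h i * C).
    by rewrite /kappa -/C -Nh; ring.
  have k0 : 0 <= T%:R * (noise m + h i * C).
    have := kappa_ge0 R n lam q d q1 (h i) m (h0 i).
    rewrite /kappa -/C => kk.
    rewrite mulr_ge0//; have hi : 0 < h i by rewrite exprn_gt0// invr_gt0.
    rewrite -(pmulr_rge0 _ hi); apply: le_trans kk _.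
    by rewrite le_eqVlt; apply/orP; left; apply/eqP; ring.
  apply: (@le_trans _ _ (E * (T%:R * (noise m + h i * C)) / a)); last first.
    by rewrite le_eqVlt; apply/orP; left; apply/eqP; ring.
  rewrite ler_wpM2r ?invr_ge0 ?(ltW a0)// ler_wpM2r//.
  have -> : E = expR ((T * 2 ^ i)%:R * ((4 + 5 * d%:R) * h i)).
    by congr expR; rewrite -Nh; ring.
  rewrite expRM_natl lerXn2r ?nnegrE ?expR_ge0 ?expR_ge1Dx//.
  by rewrite (le_trans ler01)// growth_ge1.
apply: (@ler_addM_eps _ _ _ (E * T%:R * C / a)).
  by rewrite divr_ge0 ?(ltW a0)// !mulr_ge0.
move=> e e0 _; have [i hi] := half_small e e0.
pose j := maxn i l.
apply: (@le_trans _ _ (pr (dyadic_bad m a T j))).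
  apply: pr_le; [exact: mbad|exact: mbad|].
  by apply: dyadic_bad_mono; rewrite leq_maxr.
apply: (le_trans (bnd j)); rewrite lerD2l ler_wpM2r//.
  by rewrite divr_ge0 ?(ltW a0)// !mulr_ge0.
by apply: le_trans (ltW hi); apply: half_le; rewrite leq_maxl.
Qed.

(** The threshold is [e ^+ 2 * h N]: as the weights of the first [N] coordinates are at least [h N],
    a smaller [Phi] keeps each of them within [e], and [rho_le_coord] covers the others.
    Right-continuity extends the bound from dyadic times to all times. *)
Lemma concentration (e : R) T N m : 0 < e -> e <= 1 -> (0 < N)%N ->
  N%:R^-1 <= e -> (N <= m)%N ->
  exists B : set Om, [/\ measurable B,
    pr B <= expR ((4 + 5 * d%:R) * T%:R) * T%:R * noise m / (e ^+ 2 * h N) &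
    forall w t, ~ B w -> 0 <= t -> t < T%:R ->
      rho (X w t) (flow (X w 0) t) <= e].
Proof.
move=> e0 e1 N0 Ne Nm; pose a := e ^+ 2 * h N.
have hN0 : 0 < h N by rewrite exprn_gt0// invr_gt0.
have hN1 : h N <= 1 by rewrite exprn_ile1 ?invr_ge0//; lra.
have a0 : 0 < a by rewrite mulr_gt0// exprn_gt0.
have a2 : a <= 2.
  have : a <= 1 by rewrite mulr_ile1// ?exprn_ge0 ?exprn_ile1// ltW.
  by lra.
have h0 i : 0 <= h i by rewrite exprn_ge0// invr_ge0.
have mD l : measurable (dyadic_bad m a T l) by exact: mbad.
exists (\bigcup_l dyadic_bad m a T l); split.
- exact: bigcup_measurable.
- apply: pr_bigcup_le => // [i j ij|l]; first exact: dyadic_bad_mono.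
  exact: pr_dyadic_bad.
move=> w t nB t0 tT.
have UX s : 0 <= s -> Uset (X w s) by exact: (proc_Uset R n lam q d dm Om P X Xproc w s).
have UX0 := UX 0 (lexx _).
have Uf s : 0 <= s -> Uset (flow (X w 0) s) by exact: flow_Uset.
have dyad l j : (j <= T * 2 ^ l)%N ->
    rho (X w (j%:R * h l)) (flow (X w 0) (j%:R * h l)) <= e.
  move=> jT; have s0 : 0 <= j%:R * h l by rewrite mulr_ge0.
  have lt : Phi m (X w (j%:R * h l)) (flow (X w 0) (j%:R * h l)) < a.
    by rewrite ltNge; apply/negP => ge; apply: nB; exists l => //; exists j.
  apply: (@rho_le_coord _ _ _ _ N) => //; [exact: UX|exact: Uf|exact: ltW|].
  case=> [_|k kN].
    have [-> _] := UX _ s0; have [-> _] := Uf _ s0.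
    by rewrite subrr normr0 ltW.
  have km : (k < m)%N by exact: leq_trans Nm.
  have := lt; rewrite /Phi (bigD1 (Ordinal km))//=.
  set D := X w _ _ - _; set rest := \sum_(_ | _) _ => lt'.
  have r0 : 0 <= rest.
    by apply: sumr_ge0 => i _; rewrite mulr_ge0 ?sqr_ge0.
  have hk : h N <= h k by apply: half_le; exact: ltnW.
  have D2 : 0 <= D ^+ 2 by exact: sqr_ge0.
  have : h N * D ^+ 2 < h N * e ^+ 2.
    apply: (@le_lt_trans _ _ (h k * D ^+ 2)); first by rewrite ler_wpM2r.
    by rewrite [ltRHS]mulrC -/a; lra.
  rewrite ltr_pM2l// -(real_normK (num_real D)) => lt2.
  by rewrite -(@ler_pXn2r _ 2) ?nnegrE ?(ltW e0)// ltW.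
have [fl _] := flowP R lam d lam0 lam1 _ UX0.
have cfl := flow_cadlag R lam d lam0 lam1 _ fl.
have [cX _] := Xproc.
apply/ler_addgt0Pr => eta eta0.
have eta2 : 0 < eta / 2 by rewrite divr_gt0.
have [_ [rX _]] := cX w; have [dX dX0 hX] := rX t t0 _ eta2.
have [_ [rf _]] := cfl; have [df df0 hf] := rf t t0 _ eta2.
pose del := Num.min (Num.min dX df) (T%:R - t).
have del0 : 0 < del by rewrite !lt_min dX0 df0 subr_gt0.
have [l hl] := half_small del del0.
(* [j%:R * h l] is the first grid point strictly after [t]; it is at most [T%:R] because
   [del <= T%:R - t]. *)
pose j := (Num.trunc (t / h l)).+1.
have hl0 : 0 < h l by rewrite exprn_gt0// invr_gt0.
have th0 : 0 <= t / h l by rewrite divr_ge0// ltW.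
have /andP[j1 j2] := truncn_itv th0.
have ts : t < j%:R * h l by rewrite -ltr_pdivrMr.
have sd : j%:R * h l < t + del.
  rewrite /j -[in ltLHS]natr1 mulrDl mul1r.
  by move: j1; rewrite ler_pdivlMr//; lra.
have [d1 [d2 d3]] : del <= dX /\ del <= df /\ del <= T%:R - t.
  by rewrite /del !ge_min !lexx !orbT.
have jT : (j <= T * 2 ^ l)%N.
  rewrite -(ler_nat R) -(ler_pM2r hl0) natrM half_exp2 mulfK.
    by rewrite -half_exp2; lra.
  by rewrite pnatr_eq0 expn_eq0.
have s0 : 0 <= j%:R * h l by rewrite mulr_ge0.
have r1 : rho (X w (j%:R * h l)) (X w t) < eta / 2.
  by apply: hX; [exact: ltW|lra].
have r2 : rho (flow (X w 0) (j%:R * h l)) (flow (X w 0) t) < eta / 2.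
  by apply: hf; [exact: ltW|lra].
have r3 := dyad l j jT.
have t1 := rho_triangle _ (X w (j%:R * h l)) _ (UX _ t0) (UX _ s0) (Uf _ t0).
have t2 := rho_triangle _ (flow (X w 0) (j%:R * h l)) _ (UX _ s0) (Uf _ s0) (Uf _ t0).
by rewrite rho_sym in r1; lra.
Qed.

End Concentration.

(** * Coding states by words *)

Section Words.
Variable R : realType.
Implicit Types (u : seqR R) (w : seq bool).

(* Bit [i] compares one coordinate of [u] with one rational; the index [i]
   runs through all pairs (coordinate, rational). *)
Definition bit (i : nat) u : bool :=
  if unpickle i is Some (k, N, j) then j%:R / N.+1%:R <= u k :> R else false.

(* The most recent bit comes first, so that extending a word is consing. *)
Fixpoint word (m : nat) u : seq bool :=
  if m is m'.+1 then bit m' u :: word m' u else [::].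

Lemma size_word m u : size (word m u) = m.
Proof. by elim: m => //= m ->. Qed.

Lemma word_bit m u u' i : word m u = word m u' -> (i < m)%N -> bit i u = bit i u'.
Proof.
elim: m => //= m IH [e1 e2]; rewrite ltnS leq_eqVlt => /orP[/eqP ->//|].
exact: IH.
Qed.

Lemma word_le m m' u u' : (m <= m')%N -> word m' u = word m' u' ->
  word m u = word m u'.
Proof.
elim: m' => [|m' IH]; first by rewrite leqn0 => /eqP ->.
rewrite leq_eqVlt => /orP[/eqP -> //|mm']; case=> _; exact: IH.
Qed.

(** If [u k] exceeds [u' k] by more than [N.+1%:R^-1], the largest level [j%:R / N.+1%:R] not above
    [u k] separates them. The word is taken long enough to contain all these comparisons. *)
Lemma word_close K (e : R) : 0 < e -> exists m, forall u u', Uset u -> Uset u' ->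
  word m u = word m u' -> forall k, (k <= K)%N -> `|u k - u' k| <= e.
Proof.
move=> e0; pose N := Num.trunc e^-1.
have Ne : N.+1%:R^-1 <= e.
  by rewrite -[leRHS]invrK lef_pV2 ?posrE ?invr_gt0// ltW// truncnS_gt.
pose idx (k : 'I_K.+1) (j : 'I_N.+2) := pickle ((k : nat), N, (j : nat)).
exists (\max_k \max_j idx k j).+1.
have key u u' k : Uset u -> Uset u' ->
    word (\max_k \max_j idx k j).+1 u = word (\max_k \max_j idx k j).+1 u' ->
    (k <= K)%N -> u k - u' k <= e.
  move=> Uu Uu' ew kK; rewrite leNgt; apply/negP => lt.
  have N0 : 0 < N.+1%:R :> R by rewrite ltr0n.
  have u0 := Uset_ge0 _ u k Uu; have u1 := Uset_le1 _ u k Uu.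
  have uN : 0 <= u k * N.+1%:R by rewrite mulr_ge0.
  have /andP[j1 j2] := truncn_itv uN.
  set j := Num.trunc _ in j1 j2.
  have jN : (j < N.+2)%N.
    by rewrite ltnS -(ler_nat R) (le_trans j1)// ler_piMl.
  have lti : (pickle (k, N, j) < (\max_k \max_j idx k j).+1)%N.
    rewrite ltnS; apply: leq_trans (leq_bigmax (Ordinal (kK : (k < K.+1)%N))).
    exact: leq_trans (leq_bigmax (Ordinal jN)).
  have := word_bit _ _ _ _ ew lti; rewrite /bit pickleK.
  have -> : j%:R / N.+1%:R <= u k by rewrite ler_pdivrMr.
  move=> /esym; rewrite ler_pdivrMr// leNgt => /negP; apply.
  have NV : N.+1%:R^-1 * N.+1%:R = 1 :> R by rewrite mulVf// gt_eqF.
  have : 0 < (u k - u' k - N.+1%:R^-1) * N.+1%:R by rewrite mulr_gt0// subr_gt0 (le_lt_trans Ne).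
  by rewrite !mulrBl NV; move: j2; rewrite -[j.+1%:R]natr1; lra.
move=> u u' Uu Uu' ew k kK; rewrite ler_norml lerNl opprB.
by rewrite (key u' u k)// (key u u' k).
Qed.

Lemma Uset_lim (us : nat -> seqR R) u : (forall n, Uset (us n)) ->
  (forall k, (fun n => us n k) @ \oo --> u k) -> Uset u.
Proof.
move=> Uus h; split.
  have : (fun n => us n 0%N) @ \oo --> (1 : R).
    by apply: cvg_near_cst; apply: nearW => n; case: (Uus n).
  by move=> /(cvg_unique _ (h 0%N)) ->.
split=> k.
  apply: (ler_cvg_to (h k.+1) (h k)); apply: nearW => n; exact: Uset_S.
by apply: (cvgr_to_ge (h k)); apply: nearW => n; exact: Uset_ge0.
Qed.

Lemma unit_cauchy_cvg (a : nat -> R) : (forall n, 0 <= a n <= 1) ->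
  (forall e, 0 < e -> exists m, forall m', (m <= m')%N -> `|a m' - a m| <= e) ->
  exists l : R, a @ \oo --> l.
Proof.
move=> a01 ca; have [G UG sG] := ultra_oo.
have [l al] := ultra_unit_cvg G a UG a01; exists l.
apply/cvgrPdist_le => e e0; have e2 : 0 < e / 3 by rewrite divr_gt0.
have [m hm] := ca _ e2.
have near1 : \forall n \near G, `|l - a n| <= e / 3.
  by have /cvgrPdist_le := al; apply.
have near2 : \forall n \near G, (m <= n)%N by apply: sG; exact: nbhs_infty_ge.
have [n [n1 n2]] := filter_ex (filterI near1 near2).
near=> m'; have mm' : (m <= m')%N by near: m'; exact: nbhs_infty_ge.
have h1 := hm n n2; have h2 := hm m' mm'.
by move: h1 h2 n1; rewrite !ler_norml; lra.
Unshelve. all: by end_near. Qed.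

End Words.

(** * Uniform continuity of functionals around the flow lines *)

Section UniformContinuity.
Variables (R : realType) (lam : R) (d : nat).
Hypotheses (lam0 : 0 <= lam) (lam1 : lam <= 1).
Local Notation flow := (flow R lam d).
Local Notation word := (word R).

Lemma cadlag_flow u : Uset u -> cadlag (flow u).
Proof.
move=> Uu; have [fl _] := flowP R lam d lam0 lam1 u Uu.
exact: (flow_cadlag R lam d lam0 lam1).
Qed.

Lemma sk_cvg_flow (f : pathR R -> R) (us : nat -> seqR R) u : sk_continuous f ->
  (forall n, Uset (us n)) -> (forall k, (fun n => us n k) @ \oo --> u k) ->
  (fun n => f (flow (us n))) @ \oo --> f (flow u).
Proof.
move=> cf Uus h; have Uu := Uset_lim _ us u Uus h.
apply: cf; [by move=> n; exact: cadlag_flow|exact: cadlag_flow|].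
apply: (sk_conv_flow R lam d lam0 lam1 _ us) => //.
  by move=> n; exact: cadlag_flow.
by move=> T e e0; exists 0%N => n _ t _ _; rewrite rho_xx ltW.
Qed.

(** Counterexamples for all [m] would have initial states that converge along a diagonal
    subsequence. Equal words force the same limit for both states, so [f] at both paths tends to its
    value at one flow line. Expectations of [f] are thereby reduced to finite sums over words. *)
Lemma flow_uniform (f : pathR R -> R) (e : R) : sk_continuous f -> 0 < e ->
  exists m, forall u u' x, Uset u -> Uset u' -> cadlag x ->
    word m u = word m u' ->
    (forall t, 0 <= t -> t < m.+1%:R -> rho (x t) (flow u t) <= m.+1%:R^-1) ->
    `|f x - f (flow u')| <= e.
Proof.
move=> cf e0; apply: contrapT => /forallNP nex.
have /choice[c cP] (m : nat) : exists c : seqR R * seqR R * pathR R,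
    [/\ Uset c.1.1, Uset c.1.2, cadlag c.2, word m c.1.1 = word m c.1.2 &
    (forall t, 0 <= t -> t < m.+1%:R -> rho (c.2 t) (flow c.1.1 t) <= m.+1%:R^-1)
    /\ e < `|f c.2 - f (flow c.1.2)|].
  have := nex m; move=> /existsNP[u /existsNP[u' /existsNP[x]]].
  move=> /not_implyP[Uu /not_implyP[Uu' /not_implyP[cx /not_implyP[ew]]]].
  move=> /not_implyP[hx /negP]; rewrite -ltNge => lt.
  by exists (u, u', x).
have u01 k n : 0 <= (c n).1.1 k <= 1.
  by case: (cP n) => Uu _ _ _ _; rewrite Uset_ge0// Uset_le1.
have [psi [psiS [l hl]]] := diagonal_subsequence (fun k n => (c n).1.1 k) u01.
have psi_ge n : (n <= psi n)%N.
  by elim: n => // n IH; exact: leq_ltn_trans (psiS n).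
have Ul : Uset l.
  by apply: (@Uset_lim _ (fun n => (c (psi n)).1.1)) => // n; case: (cP (psi n)).
have hl' k : (fun n => (c (psi n)).1.2 k) @ \oo --> l k.
  apply/cvgrPdist_le => e' e'0; have e2 : 0 < e' / 2 by rewrite divr_gt0.
  have [m hm] := word_close R k _ e2.
  near=> n.
  have h1 : `|l k - (c (psi n)).1.1 k| <= e' / 2.
    by near: n; have /cvgrPdist_le := hl k; apply.
  have mn : (m <= n)%N by near: n; exact: nbhs_infty_ge.
  case: (cP (psi n)) => Uu Uu' _ ew _.
  have h2 := hm _ _ Uu Uu' (word_le _ _ _ _ _ (leq_trans mn (psi_ge n)) ew) k (leqnn k).
  by move: h1 h2; rewrite !ler_norml; lra.
have c1 : (fun n => f (c (psi n)).2) @ \oo --> f (flow l).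
  apply: cf => [n||]; [by case: (cP (psi n))|exact: cadlag_flow|].
  apply: (sk_conv_flow R lam d lam0 lam1 _ (fun n => (c (psi n)).1.1)) => //.
  - by move=> n; case: (cP (psi n)).
  - by move=> n; case: (cP (psi n)).
  move=> T e' e'0.
  have [N1 _ hN1] : \forall n \near \oo, T <= n%:R :> R by exact: nbhs_infty_ger.
  have [N2 _ hN2] : \forall n \near \oo, e'^-1 <= n%:R :> R by exact: nbhs_infty_ger.
  exists (maxn N1 N2) => n; rewrite geq_max => /andP[n1 n2] t t0 tT.
  case: (cP (psi n)) => _ _ _ _ [hx _].
  have pn : n%:R <= (psi n)%:R :> R by rewrite ler_nat.
  have p1 : (psi n).+1%:R = (psi n)%:R + 1 :> R by rewrite natr1.
  apply: le_trans (hx t t0 _) _.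
    by have := hN1 n n1 => /= ?; rewrite p1; lra.
  rewrite -[leRHS]invrK lef_pV2 ?posrE ?invr_gt0//.
  by have := hN2 n n2 => /= ?; rewrite p1; lra.
have c2 : (fun n => f (flow (c (psi n)).1.2)) @ \oo --> f (flow l).
  by apply: sk_cvg_flow => // n; case: (cP (psi n)).
have e3 : 0 < e / 2 by rewrite divr_gt0.
have /cvgrPdist_le /(_ _ e3) h1 := c1.
have /cvgrPdist_le /(_ _ e3) h2 := c2.
have [n [n1 n2]] := filter_ex (filterI h1 h2).
case: (cP (psi n)) => _ _ _ _ [_]; apply/negP; rewrite -leNgt.
by move: n1 n2; rewrite !ler_norml; lra.
Unshelve. all: by end_near. Qed.

End UniformContinuity.

(** * Expectations of functions of a word *)

Section WordIntegral.
Variables (R : realType) (dm : measure_display) (Om : measurableType dm).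
Variable Q : probability Om R.
Variables (m : nat) (W : Om -> seq bool).
Hypothesis sW : forall w, size (W w) = m.
Hypothesis mW : forall b, measurable [set w | W w = b].

Lemma integrable_bounded (f : Om -> R) (M : R) : measurable_fun setT f ->
  (forall w, `|f w| <= M) -> Q.-integrable setT (EFin \o f).
Proof.
move=> mf bf; apply: measurable_bounded_integrable => //.
  by rewrite ltey_eq fin_num_measure.
exists M; split; first exact: num_real.
by move=> x Mx w _ /=; apply: (le_trans (bf w)); exact: ltW.
Qed.

Lemma word_indic (c : seq bool -> R) w :
  c (W w) = \sum_(b : m.-tuple bool) c b * \1_[set w | W w = b] w.
Proof.
have sz : size (W w) == m by rewrite sW.
rewrite (bigD1 (Tuple sz))//= big1 ?addr0.
  by rewrite indicE mem_set// mulr1.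
move=> b bW; rewrite indicE memNset ?mulr0//= => e.
by move: bW; rewrite -val_eqE /= e eqxx.
Qed.

Lemma measurable_word (c : seq bool -> R) : measurable_fun setT (fun w => c (W w)).
Proof.
rewrite (_ : (fun w => c (W w)) =
  (fun w => \sum_(b : m.-tuple bool) c b * \1_[set w | W w = b] w)); last first.
  by apply/funext => w; exact: word_indic.
by apply: measurable_sum => b; exact: measurable_funM.
Qed.

Lemma integral_word (c : seq bool -> R) (M : R) : (forall b, `|c b| <= M) ->
  (\int[Q]_w (c (W w))%:E = (\sum_(b : m.-tuple bool) c b * pr Q [set w | W w = b])%:E)%E.
Proof.
move=> cM.
under eq_integral do rewrite word_indic -sumEFin.
rewrite integral_sum//; last first.
  move=> b.
  apply: (@integrable_bounded (fun w => c b * \1_[set w | W w = b] w) M).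
    exact: measurable_funM.
  move=> w; rewrite normrM indicE; case: (_ \in _); rewrite ?normr1 ?mulr1//.
  by rewrite normr0 mulr0 (le_trans _ (cM b)).
rewrite -sumEFin; apply: eq_bigr => b _.
under eq_integral do rewrite EFinM.
rewrite integralZl//; last first.
  apply: (@integrable_bounded (fun w => \1_[set w | W w = b] w) 1).
    exact: measurable_indic.
  by move=> w; rewrite indicE; case: (_ \in _); rewrite ?normr1 ?normr0.
by rewrite integral_indic// setIT EFinM; congr (_ * _)%E; exact: prE.
Qed.

(** Off [B] the integrands differ by at most [e], on [B] by at most [2 * M]. *)
Lemma integral_word_approx (f : Om -> R) (c : seq bool -> R) (M e : R) (B : set Om) :
  measurable_fun setT f -> (forall w, `|f w| <= M) -> (forall b, `|c b| <= M) ->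
  measurable B -> 0 <= e -> (forall w, ~ B w -> `|f w - c (W w)| <= e) ->
  `|fine (\int[Q]_w (f w)%:E)%E - \sum_(b : m.-tuple bool) c b * pr Q [set w | W w = b]|
    <= e + 2 * M * pr Q B.
Proof.
move=> mf fM cM mB e0 hB.
have M0 : 0 <= M by exact: le_trans (cM [::]).
have mc := measurable_word c.
have If := integrable_bounded f M mf fM.
have Ic : Q.-integrable setT (EFin \o (fun w => c (W w))).
  exact: (integrable_bounded _ M).
have -> : \sum_(b : m.-tuple bool) c b * pr Q [set w | W w = b] =
    fine (\int[Q]_w (c (W w))%:E)%E by rewrite (integral_word c M).
rewrite -[X in `|X - _|]/(\int[Q]_(w in setT) f w)%R.
rewrite -[X in `|_ - X|]/(\int[Q]_(w in setT) c (W w))%R.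
rewrite -RintegralB//.
have Id : Q.-integrable setT (EFin \o (fun w => f w - c (W w))).
  apply: (integrable_bounded _ (M + M)); first exact: measurable_funB.
  by move=> w; apply: (le_trans (ler_normB _ _)); rewrite lerD.
apply: (le_trans (le_normr_Rintegral _ _)) => //.
pose g w := e + 2 * M * \1_B w : R.
have Ig : Q.-integrable setT (EFin \o g).
  apply: (integrable_bounded _ (e + 2 * M)).
    by apply: measurable_funD => //; exact: measurable_funM.
  move=> w; rewrite /g indicE ger0_norm; last by rewrite addr_ge0// !mulr_ge0.
  rewrite lerD2l ler_piMr ?mulr_ge0//.
  by case: (_ \in _).
have -> : e + 2 * M * pr Q B = (\int[Q]_(w in setT) g w)%R.
  rewrite /g RintegralD//.
  - rewrite RintegralZl//.
      rewrite Rintegral_cst//; congr (_ + _ * _).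
        by rewrite -[LHS]mulr1; congr (_ * _); rewrite -(prT _ _ _ Q).
      by rewrite /Rintegral integral_indic// setIT.
    apply: (integrable_bounded _ 1); first exact: measurable_indic.
    by move=> w; rewrite indicE; case: (_ \in _); rewrite ?normr1 ?normr0.
  - by apply: (integrable_bounded _ `|e|).
  - apply: (integrable_bounded _ (2 * M)).
      exact: measurable_funM.
    move=> w; rewrite indicE ger0_norm ?mulr_ge0// ler_piMr ?mulr_ge0//.
    by case: (_ \in _).
apply: le_Rintegral => //.
  apply: (integrable_bounded _ (M + M)).
    by apply: measurableT_comp => //; exact: measurable_funB.
  by move=> w; rewrite normr_id; apply: (le_trans (ler_normB _ _)); rewrite lerD.
move=> w _; rewrite /g indicE; have [wB|wB] := boolP (w \in B).
  rewrite mulr1 (le_trans (ler_normB _ _))//.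
  by have := fM w; have := cM (W w); lra.
rewrite mulr0 addr0; apply: hB; move: wB; by rewrite notin_setE.
Qed.

End WordIntegral.

(** * A random initial state with prescribed word probabilities *)

Section WordMeasure.
Variables (R : realType) (p : seq bool -> R).
Hypothesis p_ge0 : forall b, 0 <= p b.
Hypothesis p_nil : p [::] = 1.
Hypothesis p_cons : forall b, p b = p (false :: b) + p (true :: b).

Fixpoint wleft (b : seq bool) : R :=
  if b is c :: b' then wleft b' + (if c then p (false :: b') else 0) else 0.

(* The half-open intervals of length [p b] starting at [wleft b] form nested
   partitions of [0, 1); [wpath m x] is the word of length [m] containing [x]. *)
Fixpoint wpath (m : nat) (x : R) : seq bool :=
  if m is m'.+1 then
    (wleft (wpath m' x) + p (false :: wpath m' x) <= x) :: wpath m' x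
  else [::].

(** The sample space is the whole line under the uniform law of [0, 1]. Sending the null set outside
    [0, 1) to 0 makes the later statements true at every sample point. *)
Definition clamp01 (x : R) : R := if 0 <= x < 1 then x else 0.

Lemma clamp01_itv x : 0 <= clamp01 x < 1.
Proof. by rewrite /clamp01; case: ifP => // _; rewrite lexx ltr01. Qed.

Lemma size_wpath m x : size (wpath m x) = m.
Proof. by elim: m => //= m ->. Qed.

Lemma wpath_itv m x : 0 <= x < 1 ->
  wleft (wpath m x) <= x < wleft (wpath m x) + p (wpath m x).
Proof.
move=> x01; elim: m => [|m /andP[IH1 IH2]] /=; first by rewrite p_nil add0r.
have := p_cons (wpath m x).
by case: (leP (wleft (wpath m x) + p (false :: wpath m x)) x) => h /=; lra.
Qed.

(** A half-open interval containing [x] has positive length, so every sample point, not merely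
    almost every one, meets only words of positive limiting probability. *)
Lemma wpath_gt0 m x : 0 <= x < 1 -> 0 < p (wpath m x).
Proof. by move=> /(wpath_itv m)/andP[]; lra. Qed.

Lemma wleft_itv b : 0 <= wleft b /\ wleft b + p b <= 1.
Proof.
elim: b => [|c b [IH1 IH2]] /=; first by rewrite p_nil add0r.
have := p_cons b; have := p_ge0 (false :: b); have := p_ge0 (true :: b).
by case: c; lra.
Qed.

Lemma wpath_eq b x : wleft b <= x < wleft b + p b -> wpath (size b) x = b.
Proof.
elim: b => //= c b IH /andP[h1 h2].
have := p_cons b; have := p_ge0 (false :: b); have := p_ge0 (true :: b) => h3 h4 h5.
have e : wpath (size b) x = b by apply: IH; case: c h1 h2; lra.
rewrite e; congr (_ :: _); case: c h1 h2 => h1 h2; first exact: h1.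
by apply/negbTE; rewrite -ltNge; lra.
Qed.

Let Q : probability (measurableTypeR R) R := uniform_prob (@ltr01 R).

Lemma uniform_itv (a b : R) : 0 <= a -> a <= b -> b <= 1 ->
  pr Q `[a, b[%classic = b - a.
Proof.
move=> a0 ab b1; rewrite /pr /= /uniform_prob integral_uniform_pdf.
rewrite setIidl; last first.
  by move=> x /=; rewrite !in_itv /= => /andP[h1 h2]; apply/andP; split; lra.
rewrite (eq_integral (fun=> 1%E)); last first.
  move=> x; rewrite inE /= in_itv /= => /andP[h1 h2].
  by rewrite /uniform_pdf subr0 invr1; have -> : 0 <= x <= 1 by lra.
rewrite integral_cst//= mul1e lebesgue_measure_itv /= lte_fin.
case: ltP => [_|ba] /=; first by [].
lra.
Qed.

Definition word_event m b : set R := [set x | wpath m (clamp01 x) = b].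

Lemma word_eventI b : word_event (size b) b `&` `[0, 1[%classic =
  `[wleft b, wleft b + p b[%classic.
Proof.
have [l0 l1] := wleft_itv b.
apply/seteqP; split=> x /=; rewrite !in_itv /=.
  move=> [e x01]; move: e; rewrite /word_event /= /clamp01 x01 => e.
  by have := wpath_itv (size b) x x01; rewrite e.
move=> xb; have x01 : 0 <= x < 1 by move/andP: xb => [h1 h2]; lra.
by split=> //; rewrite /word_event /= /clamp01 x01 wpath_eq.
Qed.

Lemma word_eventD m b : word_event m b `\` `[0, 1[%classic =
  if wpath m 0 == b then ~` `[0, 1[%classic else set0.
Proof.
apply/seteqP; split=> x.
  move=> [+ nx]; rewrite /word_event /= /clamp01.
  have -> : (0 <= x < 1) = false by apply/negP => h; apply: nx; rewrite /= in_itv.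
  by move=> /eqP ->.
case: eqP => // e nx; split=> //; rewrite /word_event /= /clamp01.
by have -> : (0 <= x < 1) = false by apply/negP => h; apply: nx; rewrite /= in_itv.
Qed.

Lemma measurable_word_event m b : measurable (word_event m b : set (measurableTypeR R)).
Proof.
have [<-|nb] := eqVneq (size b) m; last first.
  rewrite (_ : word_event m b = set0)//; apply/seteqP; split=> // x.
  by rewrite /word_event /= => e; move: nb; rewrite -e size_wpath eqxx.
rewrite -(setUIDK (word_event (size b) b) `[0, 1[%classic).
rewrite word_eventI word_eventD; apply: measurableU; first exact: measurable_itv.
by case: ifP => _ //; apply: measurableC; exact: measurable_itv.
Qed.

Lemma pr_word_event b : pr Q (word_event (size b) b) = p b.
Proof.
have m01 : measurable (`[0, 1[%classic : set (measurableTypeR R)).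
  exact: measurable_itv.
have mE := measurable_word_event (size b) b.
have [l0 l1] := wleft_itv b; have p0 := p_ge0 b.
rewrite (pr_split _ _ _ Q _ _ mE m01) word_eventI uniform_itv//; last lra.
suff -> : pr Q (word_event (size b) b `\` `[0, 1[%classic) = 0 by lra.
apply/eqP; rewrite eq_le pr_ge0 andbT.
apply: (@le_trans _ _ (pr Q (~` `[0, 1[%classic))).
  by apply: pr_le; [exact: measurableD|exact: measurableC|move=> x []].
by rewrite pr_setC// uniform_itv// subr0 subrr.
Qed.

End WordMeasure.

(** * Representative states of words *)

Section Representatives.
Variable R : realType.
Local Notation word := (word R).

(** The default is the empty system, so that [rep b] lies in U for every [b]. *)
Definition rep (b : seq bool) : seqR R :=
  xget (fun k => if k is 0%N then 1 else 0) [set u | Uset u /\ word (size b) u = b].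

Lemma rep_Uset b : Uset (rep b).
Proof.
rewrite /rep; case: xgetP => [u -> []//|_].
split=> //; split; first by case=> [|k]; rewrite ?ler01 ?lexx.
by case=> [|k]; rewrite ?ler01 ?lexx.
Qed.

Lemma rep_word b u : Uset u -> word (size b) u = b -> word (size b) (rep b) = b.
Proof.
by move=> Uu e; rewrite /rep; case: xgetP => [v -> []//|/(_ u)]; case.
Qed.

Lemma rep_wpath (p : seq bool -> R) x m m' :
  (forall m, exists2 u, Uset u & word m u = wpath R p m x) -> (m <= m')%N ->
  word m (rep (wpath R p m' x)) = wpath R p m x.
Proof.
move=> ex; have rw i : word i (rep (wpath R p i x)) = wpath R p i x.
  have [u Uu ew] := ex i.
  by have := rep_word (wpath R p i x) u Uu; rewrite size_wpath; apply.
elim: m' => [|m' IH]; first by rewrite leqn0 => /eqP ->; exact: rw.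
rewrite leq_eqVlt => /orP[/eqP ->|mm']; first exact: rw.
rewrite -IH//; have := rw m'.+1; rewrite /= => -[_ e].
by apply: (word_le _ _ m') => //; rewrite e rw.
Qed.

(** Later representatives share all bits of the earlier ones, so each coordinate is a Cauchy
    sequence by [word_close]. *)
Lemma rep_cvg (p : seq bool -> R) x :
  (forall m, exists2 u, Uset u & word m u = wpath R p m x) ->
  exists v : seqR R, Uset v /\
    forall k, (fun m => rep (wpath R p m x) k) @ \oo --> v k.
Proof.
move=> ex.
have /choice[v vP] (k : nat) : exists l : R, (fun m => rep (wpath R p m x) k) @ \oo --> l.
  apply: unit_cauchy_cvg => [m|e e0].
    by rewrite Uset_ge0 ?Uset_le1//; exact: rep_Uset.
  have [m hm] := word_close R k e e0; exists m => m' mm'.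
  apply: (hm _ _ (rep_Uset _) (rep_Uset _)) => //.
  by rewrite !rep_wpath.
exists v; split=> //; apply: (@Uset_lim _ (fun m => rep (wpath R p m x))) => // m.
exact: rep_Uset.
Qed.

End Representatives.

Lemma noise_cvg {R : realType} (q : R) d : 0 < q -> q <= 1 ->
  (fun n => noise R n q d n) @ \oo --> (0 : R).
Proof.
move=> q0 q1; rewrite /noise.
have h1 : (fun n => 4 / n%:R : R) @ \oo --> (0 : R).
  rewrite -[X in _ --> X](mulr0 4); apply: cvgMr.
  by rewrite -cvg_shiftS; exact: cvg_harmonic.
have h2 : (fun n => 4 * (1 - q) ^+ n : R) @ \oo --> (0 : R).
  rewrite -[X in _ --> X](mulr0 4); apply: cvgMr.
  by apply: cvg_expr; rewrite ltr_norml; lra.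
have h3 : (fun n => 2 * d%:R * (2^-1) ^+ n : R) @ \oo --> (0 : R).
  rewrite -[X in _ --> X](mulr0 (2 * d%:R)); apply: cvgMr.
  by apply: cvg_expr; rewrite ltr_norml; lra.
rewrite -[X in _ --> X](addr0 (0 : R)) -[X in _ --> X + _](addr0 (0 : R)).
by apply: cvgD => //; apply: cvgD.
Qed.

(** * Convergence *)

Theorem theorem3p1 (R : realType) (d : nat) (lam q : R)
  (dm : nat -> measure_display) (Om : forall n, measurableType (dm n))
  (P : forall n, probability (Om n) R) (X : forall n, Om n -> pathR R) :
  (0 < d)%N -> 0 < lam -> lam < 1 -> 0 < q -> q <= 1 ->
  (forall n, (0 < n)%N -> random_element (X n)) ->
  (forall n, (0 < n)%N -> is_LCQ_process n lam q d (P n) (X n)) ->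
  forall phi : nat -> nat, (forall j, (phi j < phi j.+1)%N) ->
  exists psi : nat -> nat, (forall j, (psi j < psi j.+1)%N) /\
  exists (d' : measure_display) (Om' : measurableType d')
         (P' : probability Om' R) (V : Om' -> pathR R),
    random_element V /\
    (forall w (t : R), 0 <= t -> V w t 0%N = 1) /\
    (forall w (k : nat), (0 < k)%N ->
       (forall t : R, 0 < t ->
          is_derive t 1 (fun s => V w s k) (lcq_rhs lam d (V w t) k)) /\
       ((fun h : R => h^-1 * (V w h k - V w 0 k)) @ 0^'+ -->
          lcq_rhs lam d (V w 0) k)) /\
    conv_dist (fun j => P (phi (psi j))) (fun j => X (phi (psi j))) P' V.
Proof.
move=> _ lam_gt0 lam_lt1 q0 q1 rX pX phi phiS.
have lam0 := ltW lam_gt0; have lam1 := ltW lam_lt1.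
have phi_ge n : (n <= phi n)%N.
  by elim: n => // n IH; exact: leq_ltn_trans (phiS n).
(* The shift to [j.+1] makes the system size positive. *)
pose init j b := [set w : Om (phi j.+1) | word R (size b) (X (phi j.+1) w 0) = b].
have phi0 j : (0 < phi j.+1)%N by exact: leq_trans (phi_ge _).
have minit j m b : measurable [set w : Om (phi j.+1) | word R m (X (phi j.+1) w 0) = b].
  exact: (measurable_state2 _ _ _ _ _ _ _ _ _ (phi0 j) (pX _ (phi0 j)) 0 0
    (fun x _ => word R m x = b)).
pose pj j b := pr (P (phi j.+1)) (init j b).
have pj01 i j : 0 <= pj j (odflt [::] (unpickle i)) <= 1.
  rewrite pr_ge0 /= -(prT _ _ _ (P (phi j.+1))); apply: pr_le => //.
  exact: minit.
have [psi [psiS [l hl]]] :=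
  diagonal_subsequence (fun i j => pj j (odflt [::] (unpickle i))) pj01.
pose p (b : seq bool) : R := l (pickle b).
have pcvg b : (fun j => pj (psi j) b) @ \oo --> p b.
  by have := hl (pickle b); rewrite pickleK.
have p_ge0 b : 0 <= p b.
  by apply: (cvgr_to_ge (pcvg b)); apply: nearW => j; exact: pr_ge0.
have p_nil : p [::] = 1.
  apply: (cvg_unique _ (pcvg [::])) => //; apply: cvg_near_cst; apply: nearW => j.
  rewrite /pj /init /= -(prT _ _ _ (P (phi (psi j).+1))); congr pr.
  by apply/seteqP; split.
have pjS n b : pj n b = pj n (false :: b) + pj n (true :: b).
  pose A := [set w | bit R (size b) (X (phi n.+1) w 0) = true].
  have mA : measurable A.
    exact: (measurable_state2 _ _ _ _ _ _ _ _ _ (phi0 n) (pX _ (phi0 n)) 0 0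
      (fun x _ => bit R (size b) x = true)).
  rewrite {1}/pj (pr_split _ _ _ _ _ _ (minit n (size b) b) mA) addrC.
  rewrite /pj /init /A /=; congr (_ + _); congr pr; apply/seteqP; split=> w /=.
  - by move=> [-> /negP/negbTE ->].
  - by move=> [-> ->].
  - by move=> [-> ->].
  - by move=> [-> ->].
have p_cons b : p b = p (false :: b) + p (true :: b).
  apply: (cvg_unique _ (pcvg b)) => //.
  rewrite (_ : (fun j => _) =
      (fun j => pj (psi j) (false :: b) + pj (psi j) (true :: b))); last first.
    by apply/funext => j; exact: pjS.
  by apply: cvgD; exact: pcvg.
(* A word of positive limiting probability has positive probability in some system, hence is the
   word of an actual state. *)
have ppos b : 0 < p b -> exists2 u, Uset u & word R (size b) u = b.
  move=> pb; have /cvgrPdist_lt /(_ _ pb) [j _ hj] := pcvg b.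
  have := hj j (leqnn j); rewrite /= => hlt.
  have [e|/set0P[w hw]] := eqVneq (init (psi j) b) set0.
    by move: hlt; rewrite /pj e pr0 subr0 ger0_norm// ltxx.
  exists (X (phi (psi j).+1) w 0) => //.
  exact: (proc_Uset _ _ _ _ _ _ _ _ _ (pX _ (phi0 (psi j)))).
pose xi m x := wpath R p m (clamp01 R x).
have xi_word x m : exists2 u, Uset u & word R m u = xi m x.
  have [u Uu eu] := ppos _ (wpath_gt0 R p p_nil p_cons m _ (clamp01_itv R x)).
  by exists u => //; move: eu; rewrite size_wpath.
have [V0 V0P] := choice (fun x => rep_cvg R p _ (xi_word x)).
have V0U x : Uset (V0 x) by case: (V0P x).
have V0c x k : (fun m => rep R (xi m x) k) @ \oo --> V0 x k by case: (V0P x).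
exists (fun j => (psi j).+1); split=> //.
pose V x := flow R lam d (V0 x).
exists _, (measurableTypeR R), (uniform_prob (@ltr01 R)), V.
have fV x := flowP R lam d lam0 lam1 _ (V0U x).
have mxi m b : measurable [set x : measurableTypeR R | xi m x = b].
  exact: (measurable_word_event R p p_ge0 p_nil p_cons).
have sxi m x : size (xi m x) = m by exact: size_wpath.
have Vcvg f x : sk_continuous f ->
    (fun m => f (flow R lam d (rep R (xi m x)))) @ \oo --> f (V x).
  move=> cf; apply: sk_cvg_flow => // m; exact: rep_Uset.
(* Measurability holds because [f (V x)] is a pointwise limit of functions of finitely many bits. *)
have mfV f : sk_continuous f ->
    measurable_fun setT (fun x : measurableTypeR R => f (V x)).
  move=> cf.
  apply: (@measurable_fun_cvg _ _ _ _ (fun m x => f (flow R lam d (rep R (xi m x))))).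
    move=> m; apply: (measurable_word R _ (measurableTypeR R) m (xi m) (sxi m) (mxi m)
      (fun b => f (flow R lam d (rep R b)))).
  by move=> x _; exact: Vcvg.
split; first by split=> [x|f _ cf]; [exact: cadlag_flow|exact: mfV].
split; first by move=> x t t0; case: (flow_Uset R lam d lam0 lam1 _ _ (V0U x) t0).
split.
  move=> x [//|k] _; split=> [t t0|].
    by apply: flow_derive => //; case: (fV x).
  by apply: flow_derive0 => //; case: (fV x).
move=> f [M fM] cf.
pose n j := phi (psi j).+1.
have n0 j : (0 < n j)%N by exact: phi0.
have nge j : (j <= n j)%N.
  apply: leq_trans (phi_ge _); apply: leqW.
  by elim: j => // j IH; exact: leq_ltn_trans (psiS j).
have mfX j : measurable_fun setT (fun w => f (X (n j) w)).
  by have [_ h] := rX _ (n0 j); apply: h => //; exists M.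
have IX j := integrable_bounded _ _ _ (P (n j)) _ M (mfX j) (fun w => fM _).
have IV := integrable_bounded _ _ (measurableTypeR R) (uniform_prob (@ltr01 R))
  _ M (mfV f cf) (fun w => fM _).
rewrite -[X in _ --> X]fineK; last exact: integrable_fin_num.
apply: cvg_EFin; first by apply: nearW => j; exact: (integrable_fin_num _ (IX j)).
apply/cvgrPdist_le => e e0.
have M0 : 0 <= M by exact: le_trans (fM (fun _ _ => 0)).
have e4 : 0 < e / 4 by rewrite divr_gt0.
(* [m] is fixed here, before [j] grows; [m.+1] later serves as time horizon, as inverse accuracy and
   as number of controlled coordinates. *)
have [m hm] := flow_uniform R lam d lam0 lam1 f _ cf e4.
pose c b := f (flow R lam d (rep R b)).
have cM b : `|c b| <= M by exact: fM.
pose S := \sum_(b : m.-tuple bool) c b * p b.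
pose Sj j := \sum_(b : m.-tuple bool) c b * pj (psi j) b.
have Scvg : Sj @ \oo --> S.
  apply: cvg_big => //; first by apply: add_continuous.
  by move=> b _; apply: cvgMr; exact: pcvg.
(* Bits are not continuous, so the word of the limit state may differ from [xi m x]. The estimate is
   made for representatives of longer words and passes to the limit. *)
have hV x : `|f (V x) - c (xi m x)| <= e / 4.
  have h1 : (fun m' => `|c (xi m' x) - c (xi m x)|) @ \oo --> `|f (V x) - c (xi m x)|.
    by apply: cvg_norm; apply: cvgB; [exact: Vcvg|exact: cvg_cst].
  apply: (cvgr_to_le h1); near=> m'.
  have mm' : (m <= m')%N by near: m'; exact: nbhs_infty_ge.
  apply: (hm (rep R (xi m' x))); [exact: rep_Uset|exact: rep_Uset| | |].
  - by apply: cadlag_flow => //; exact: rep_Uset.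
  - by rewrite !(rep_wpath R p _ _ _ (xi_word x)).
  - by move=> t _ _; rewrite rho_xx invr_ge0.
have dV : `|fine (\int[uniform_prob (@ltr01 R)]_x (f (V x))%:E)%E - S| <= e / 4.
  have := integral_word_approx R _ (measurableTypeR R) (uniform_prob (@ltr01 R)) m (xi m)
    (sxi m) (mxi m) (fun x => f (V x)) c M (e / 4) set0 (mfV f cf) (fun x => fM _) cM
    measurable0 (ltW e4) (fun x _ => hV x).
  rewrite pr0 mulr0 addr0; apply: le_trans; rewrite le_eqVlt; apply/orP; left.
  apply/eqP; congr `|_ - _|; apply: eq_bigr => b _; congr (_ * _).
  by rewrite -(pr_word_event R p p_ge0 p_nil p_cons) size_tuple.
(* The constant of [concentration] for these parameters; it does not depend on [j]. *)
pose A : R := expR ((4 + 5 * d%:R) * m.+1%:R) * m.+1%:R /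
  (m.+1%:R^-1 ^+ 2 * (2^-1) ^+ m.+1).
have A0 : 0 <= A.
  rewrite /A divr_ge0 ?mulr_ge0 ?expR_ge0 ?exprn_ge0 ?invr_ge0//.
have near_noise : \forall j \near \oo, 2 * M * (A * noise R (n j) q d (n j)) <= e / 4.
  have /cvgrPdist_le h : (fun k => 2 * M * (A * noise R k q d k)) @ \oo --> (0 : R).
    have -> : (0 : R) = 2 * M * (A * 0) by rewrite !mulr0.
    by apply: cvgMr; apply: cvgMr; exact: noise_cvg.
  have [N _ hN] := h _ e4; exists N => // j /= Nj.
  have := hN (n j) (leq_trans Nj (nge j)); rewrite /= sub0r normrN.
  exact: le_trans (ler_norm _).
near=> j.
have nm : (m.+1 <= n j)%N.
  by apply: leq_trans (nge j); near: j; exact: nbhs_infty_ge.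
(* [Phi] keeps [n j] coordinates, so that [noise_cvg] makes the probability of [B] vanish. *)
have [B [mB prB hB]] := concentration R (n j) lam q d _ _ (P (n j)) (X (n j)) (n0 j)
  lam0 lam1 q0 q1 (pX _ (n0 j)) m.+1%:R^-1 m.+1 m.+1 (n j) (ltac:(by rewrite invr_gt0))
  (ltac:(by rewrite invf_le1 ?ler1n)) isT (lexx _) nm.
have UX w : Uset (X (n j) w 0).
  exact: (proc_Uset _ _ _ _ _ _ _ _ _ (pX _ (n0 j))).
have dX : `|fine (\int[P (n j)]_w (f (X (n j) w))%:E)%E - Sj j| <= e / 4 + e / 4.
  have hBf w : ~ B w -> `|f (X (n j) w) - c (word R m (X (n j) w 0))| <= e / 4.
    move=> nB; apply: (hm (X (n j) w 0)) => //.
    - exact: rep_Uset.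
    - by have [cX _] := pX _ (n0 j); exact: cX.
    - have := rep_word R (word R m (X (n j) w 0)) _ (UX w).
      by rewrite size_word => ->.
    - by move=> t t0 tm; exact: hB.
  have := integral_word_approx R _ _ (P (n j)) m (fun w => word R m (X (n j) w 0))
    (fun w => size_word _ _ _) (minit (psi j) m) _ c M (e / 4) B (mfX j) (fun w => fM _) cM
    mB (ltW e4) hBf.
  rewrite (eq_bigr (fun b : m.-tuple bool => c b * pj (psi j) b)); last first.
    by move=> b _; rewrite /pj /init size_tuple.
  move=> /le_trans; apply; rewrite lerD2l.
  apply: (@le_trans _ _ (2 * M * (A * noise R (n j) q d (n j)))); last by near: j.
  rewrite ler_wpM2l ?mulr_ge0// (le_trans prB)// le_eqVlt; apply/orP; left.
  by apply/eqP; rewrite /A mulrAC.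
have dS : `|S - Sj j| <= e / 4 by near: j; have /cvgrPdist_le := Scvg; apply.
rewrite /= -/(n j); move: dV dX dS; rewrite !ler_norml.
by move=> /andP[? ?] /andP[? ?] /andP[? ?]; apply/andP; split; lra.
Unshelve. all: by end_near. Qed.
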